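(* Assume $x^{(0)}\neq0$. (a) If $a=0$, then for every $\sigma>0$, $x^{(k)}\to0$ almost surely as $k\to\infty$. (b) If $a\in(0,1]$, then $\mu_a(\sigma)<0$ if and only if $\sigma=\bar\sigma_a(s,d)$ for some $s>0$. In that case, if $s\ge1$ then $x^{(k)}\to0$ almost surely; if $s<1$ then $\mathbb E\|x^{(k)}\|^p\to0$ for every $p\in(0,s)$ and some subsequence $x^{(n_k)}$ converges to $0$ almost surely. (c) If $a\in(0,1]$ and $\mu_a(\sigma)>0$, then $\mathbb E\|x^{(k)}\|^p\to\infty$ for every $p>0$, and some subsequence satisfies $\|x^{(n_k)}\|\to\infty$ almost surely.
   Context: Fix an integer width $d\ge1$ and a parameter $a\in[0,1]$. The parametric ReLU $\phi_a:\mathbb{R}\to\mathbb{R}$ is $\phi_a(z)=z$ for $z>0$ and $\phi_a(z)=az$ for $z\le 0$; it is applied componentwise to vectors ($\phi_0$ is ReLU, $\phi_1$ is the identity). Given $\sigma>0$ and a deterministic input $x^{(0)}\in\mathbb{R}^d$, the layer outputs of the fully connected network with zero biases are $x^{(k+1)}=\phi_a(W^{(k+1)}x^{(k)})$, $k\ge0$, where all entries of all matrices $W^{(1)},W^{(2)},\dots\in\mathbb{R}^{d\times d}$ are i.i.d. $\mathcal{N}(0,\sigma^2)$. $\|\cdot\|$ denotes the Euclidean norm. With $Z\sim\mathcal N(0,I_d)$: $\mu_a(\sigma)=\log\sigma+\frac12\mathbb E[\log\|\phi_a(Z)\|^2]$, and for $s>0$, $\bar\sigma_a(s,d)=\big(\mathbb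 E\|\phi_a(Z)\|^s\big)^{-1/s}$. *)

(* Defs.v *)
From HB Require Import structures.
From mathcomp Require Import all_boot all_order all_algebra.
From mathcomp Require Import all_classical all_reals all_analysis.

Set Implicit Arguments.
Unset Strict Implicit.
Unset Printing Implicit Defensive.

Import Order.TTheory GRing.Theory Num.Theory.
Import numFieldNormedType.Exports.

Local Open Scope classical_set_scope.
Local Open Scope ring_scope.

Section defs.
Context {R : realType}.

Definition prelu (a z : R) : R := if 0 < z then z else a * z.

Definition prelu_vec (a : R) {d : nat} (v : 'cV[R]_d) : 'cV[R]_d :=
  map_mx (prelu a) v.

Definition enorm {d : nat} (v : 'cV[R]_d) : R :=
  Num.sqrt (\sum_(i < d) v i 0 ^+ 2).

(* Layer outputs: layers a x0 W 0 = x0 and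
   layers a x0 W k.+1 = phi_a (W k *m layers a x0 W k).
   W k plays the role of the paper's W^{(k+1)}. *)
Fixpoint layers (a : R) {d : nat} {T : Type} (x0 : 'cV[R]_d)
  (W : nat -> T -> 'M[R]_d) (k : nat) (w : T) : 'cV[R]_d :=
  match k with
  | 0%N => x0
  | k'.+1 => prelu_vec a (W k' w *m layers a x0 W k' w)
  end.

Definition mutually_independent {dT : measure_display} {T : measurableType dT}
  (P : probability T R) {I : eqType} (X : I -> T -> R) : Prop :=
  forall (J : seq I) (B : I -> set R), uniq J ->
    (forall i, measurable (B i)) ->
    P (\big[setI/setT]_(i <- J) (X i @^-1` B i)) =
    (\prod_(i <- J) P (X i @^-1` B i))%E.

Definition iid_gaussian {dT : measure_display} {T : measurableType dT}
  (P : probability T R) {I : eqType} (X : I -> T -> R) (s : R) : Prop :=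
  [/\ forall i, measurable_fun setT (X i),
      forall i (B : set R), measurable B -> P (X i @^-1` B) = normal_prob 0 s B
    & mutually_independent P X].

Definition mu_a {dT : measure_display} {T : measurableType dT}
  (P : probability T R) {d : nat} (Zs : 'I_d -> T -> R) (a sigma : R) : \bar R :=
  ((ln sigma)%:E +
   (2^-1)%:E * \int[P]_w (ln (enorm (prelu_vec a (\col_i Zs i w)) ^+ 2))%:E)%E.

Definition sigma_bar {dT : measure_display} {T : measurableType dT}
  (P : probability T R) {d : nat} (Zs : 'I_d -> T -> R) (a s : R) : R :=
  (fine (\int[P]_w ((enorm (prelu_vec a (\col_i Zs i w))) `^ s)%:E)) `^ (- s^-1).

End defs.

(* Main.v *)
Require Import Defs.
From HB Require Import structures.
From mathcomp Require Import all_boot all_order all_algebra.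
From mathcomp Require Import all_classical all_reals all_analysis.
From mathcomp Require Import measurable_realfun.
From mathcomp Require Import ring lra.

Set Implicit Arguments.
Unset Strict Implicit.
Unset Printing Implicit Defensive.

Import Order.TTheory GRing.Theory Num.Theory.
Import numFieldNormedType.Exports.
Local Open Scope classical_set_scope.
Local Open Scope ring_scope.

(** For a fixed vector [x] the rows of [W x] are independent and, by rotation
    invariance, distributed as [sigma |x| Z], so that [|phi_a (W x)|] has the law
    of [sigma |x| V] with [V = |phi_a Z|].  As the matrix of a layer is independent
    of the previous layers, [E g(|x_k|) = g(|x_0|) r^k] with [r = E g(sigma V)] for
    every nonnegative multiplicative [g]; if [r < 1] then [sum_k E g(|x_k|)] is
    finite and [g(|x_k|)] tends to [0] almost surely.  For [a = 0] take
    [g u = 1_(u != 0)], with [r = P(V != 0) < 1].  For [a > 0] let [psi] be the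
    moment generating function of [Y = ln (sigma V)], so that [mu_a = E Y] and
    [sigma = sigma_bar s] means [psi s = 1].  If [psi s = 1] then
    [1 + s E Y < psi s] gives [E Y < 0], hence [psi < 1] near [0+] and, by
    convexity, on [(0, s)]: take [g u = u^p].  Conversely, if [E Y < 0] then
    [psi < 1] near [0+] while [psi] is continuous and unbounded.  If [E Y > 0] then
    [psi p > 1] for [p > 0], and [psi (- q) < 1] for some small [q > 0]: taking
    [g u = u^(-q)] shows that [|x_k|] tends to infinity. *)

(** * Gaussian integrals *)

Lemma integral_probability_cst {R : realType} {d : measure_display}
    {T : measurableType d} (P : probability T R) (c : \bar R) :
  (\int[P]_w c = c)%E.
Proof. by rewrite integral_cst// [X in (_ * X)%E]probability_setT mule1. Qed.

Section normal_integrals.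
Context {R : realType}.
Local Notation mu := (@lebesgue_measure R).
Implicit Types (f : R -> \bar R) (a b m s t x y z : R).

Lemma measurable_affine a b :
  measurable_fun setT ((fun x => a * x + b) : measurableTypeR R -> measurableTypeR R).
Proof. by apply: measurable_funD => //; exact: measurable_funM. Qed.

Lemma lebesgue_measure_preimage_affine a b (A : set R) : a != 0 -> measurable A ->
  (`|a|%:E * mu ((fun x => a * x + b)%R @^-1` A) = mu A)%E.
Proof.
move=> a0 mA.
have maff := measurable_affine a b.
apply/esym.
apply: (@lebesgue_measure_unique R (mscale (NngNum (normr_ge0 a)) (pushforward mu
  ((fun x => a * x + b) : measurableTypeR R -> measurableTypeR R)))) => //= _ [[c d]] _ <-.
rewrite /mscale/= /pushforward/= lebesgue_measure_itv/= lte_fin.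
case/orP: (lt_total a0) => [a_lt0|a_gt0].
- have -> : (fun x => a * x + b) @^-1` `]c, d] = `[(d - b) / a, (c - b) / a[%classic.
    apply/seteqP; split => x /=; rewrite !in_itv/= ler_ndivrMr// ltr_ndivlMr//; lra.
  rewrite lebesgue_measure_itv/= lte_fin ltr_ndivrMr// mulfVK ?lt_eqF// ltrD2r.
  case: ifPn => // cd; last by rewrite mule0.
  by rewrite -!EFinB -EFinM ltr0_norm//; congr _%:E; field; rewrite lt_eqF.
- have -> : (fun x => a * x + b) @^-1` `]c, d] = `](c - b) / a, (d - b) / a]%classic.
    apply/seteqP; split => x /=; rewrite !in_itv/= ler_pdivlMr// ltr_pdivrMr//; lra.
  rewrite lebesgue_measure_itv/= lte_fin ltr_pdivrMr// mulfVK ?gt_eqF// ltrD2r.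
  case: ifPn => // cd; last by rewrite mule0.
  by rewrite -!EFinB -EFinM gtr0_norm//; congr _%:E; field; rewrite gt_eqF.
Qed.

Lemma ge0_integral_affine a b f : a != 0 ->
  measurable_fun setT f -> (forall x, 0 <= f x)%E ->
  (\int[mu]_x f x = \int[mu]_x (`|a|%:E * f (a * x + b)%R))%E.
Proof.
move=> a0 mf f0; have maff := measurable_affine a b.
rewrite (@eq_measure_integral _ _ _ _ (mscale (NngNum (normr_ge0 a)) (pushforward mu
  ((fun x => a * x + b) : measurableTypeR R -> measurableTypeR R)))); last first.
  by move=> A mA _; apply/esym; exact: lebesgue_measure_preimage_affine.
rewrite ge0_integral_mscale//= ge0_integral_pushforward//= preimage_setT.
by rewrite ge0_integralZl//; exact: measurableT_comp mf maff.
Qed.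

Lemma measurable_normal_pdfE m s : measurable_fun setT (fun x => (normal_pdf m s x)%:E).
Proof. by apply/measurable_EFinP; exact: measurable_normal_pdf. Qed.

Lemma ge0_integral_normal_prob m s f :
  measurable_fun setT f -> (forall x, 0 <= f x)%E ->
  (\int[normal_prob m s]_x f x = \int[mu]_x (f x * (normal_pdf m s x)%:E))%E.
Proof.
move=> mf f0.
have dom := normal_prob_dominates m s.
have mpdf := measurable_normal_pdfE m s.
have intRN := Radon_Nikodym_SigmaFinite.f_integrable dom.
rewrite -(Radon_Nikodym_SigmaFinite.change_of_variables dom)//=.
apply: ae_eq_integral => //.
- by apply: emeasurable_funM => //; exact: measurable_int intRN.
- exact: emeasurable_funM.
- apply: ae_eqe_mul2l => /=; apply: integral_ae_eq => //= E _ mE.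
  by rewrite -(Radon_Nikodym_SigmaFinite.f_integral dom).
Qed.

Lemma normal_peakE s : normal_peak s = (`|s| * Num.sqrt (pi *+ 2))^-1.
Proof. by rewrite /normal_peak -mulrnAr sqrtrM ?sqr_ge0// sqrtr_sqr. Qed.

Lemma normal_pdf_affine a b m s x : a != 0 -> s != 0 ->
  `|a| * normal_pdf (a * m + b) (`|a| * s) (a * x + b) = normal_pdf m s x.
Proof.
move=> a0 s0; rewrite !normal_pdfE ?mulf_neq0 ?normr_eq0//.
rewrite !normal_peakE /normal_fun normrM normr_id !exprMn real_normK ?num_real//.
rewrite mulrA -(mulrA `|a| `|s|) invfM mulVKf ?normr_eq0//.
congr (_ * expR _); field; rewrite a0 s0//.
Qed.

Lemma ge0_integral_normal_prob_affine a b m s f : a != 0 -> s != 0 ->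
  measurable_fun setT f -> (forall x, 0 <= f x)%E ->
  (\int[normal_prob (a * m + b) (`|a| * s)]_x f x =
   \int[normal_prob m s]_x f (a * x + b)%R)%E.
Proof.
move=> a0 s0 mf f0.
pose F x : \bar R := (f x * (normal_pdf (a * m + b) (`|a| * s) x)%:E)%E.
have mF : measurable_fun setT F by apply: emeasurable_funM => //; exact: measurable_normal_pdfE.
have F0 x : (0 <= F x)%E by rewrite mule_ge0// lee_fin normal_pdf_ge0.
rewrite [RHS]ge0_integral_normal_prob//; last first.
  exact: measurableT_comp mf (measurable_affine a b).
rewrite (ge0_integral_normal_prob _ _ mf f0) (ge0_integral_affine b a0 mF F0).
by apply: eq_integral => x _; rewrite /F muleCA -EFinM normal_pdf_affine.
Qed.

Lemma ge0_integral_normal_prob_shift y s f : s != 0 ->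
  measurable_fun setT f -> (forall x, 0 <= f x)%E ->
  (\int[normal_prob 0 s]_x f (x + y)%R = \int[normal_prob y s]_x f x)%E.
Proof.
move=> s0 mf f0.
have [y1 s1] : 1 * 0 + y = y /\ `|1| * s = s by rewrite mulr0 add0r normr1 mul1r.
rewrite -[in RHS]y1 -[in RHS]s1.
rewrite (ge0_integral_normal_prob_affine _ _ (oner_neq0 R) s0 mf f0).
by apply: eq_integral => x _; rewrite mul1r.
Qed.

Lemma ge0_integral_normal_prob_scale a f : a != 0 ->
  measurable_fun setT f -> (forall x, 0 <= f x)%E ->
  (\int[normal_prob 0 1]_x f (a * x)%R = \int[normal_prob 0 `|a|]_x f x)%E.
Proof.
move=> a0 mf f0.
have [a0E a1E] : a * 0 + 0 = 0 :> R /\ `|a| * 1 = `|a| by rewrite mulr0 addr0 mulr1.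
rewrite -[in RHS]a1E -[X in normal_prob X (_ * 1)]a0E.
rewrite (ge0_integral_normal_prob_affine _ _ a0 (oner_neq0 R) mf f0).
by apply: eq_integral => x _; rewrite addr0.
Qed.

Lemma ge0_integral_normal_prob_norm a f :
  measurable_fun setT f -> (forall x, 0 <= f x)%E ->
  (\int[normal_prob 0 1]_x f (a * x)%R = \int[normal_prob 0 1]_x f (`|a| * x)%R)%E.
Proof.
move=> mf f0; have [->|a0] := eqVneq a 0; first by rewrite normr0.
have na0 : `|a| != 0 by rewrite normr_eq0.
rewrite (ge0_integral_normal_prob_scale a0 mf f0).
by rewrite (ge0_integral_normal_prob_scale na0 mf f0) normr_id.
Qed.

(* Completing the square in [y]. *)
Lemma normal_pdf_convolution s t y z : 0 < s -> 0 < t ->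
  let r := Num.sqrt (s ^+ 2 + t ^+ 2) in
  normal_pdf y s z * normal_pdf 0 t y =
  normal_pdf 0 r z * normal_pdf (t ^+ 2 * z / r ^+ 2) (s * t / r) y.
Proof.
move=> s0 t0 r.
have r2_gt0 : 0 < s ^+ 2 + t ^+ 2 by rewrite ltr_pwDl ?exprn_gt0// sqr_ge0.
have r0 : 0 < r by rewrite sqrtr_gt0.
have r2 : r ^+ 2 = s ^+ 2 + t ^+ 2 by rewrite sqr_sqrtr// ltW.
have str0 : 0 < s * t / r by rewrite divr_gt0 ?mulr_gt0.
have sqrt_pi0 : Num.sqrt (pi *+ 2) != 0 :> R.
  by rewrite gt_eqF// sqrtr_gt0 pmulrn_lgt0// pi_gt0.
rewrite !normal_pdfE ?gt_eqF// !normal_peakE !gtr0_norm//.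
rewrite mulrACA [RHS]mulrACA /normal_fun -!expRD; congr (_ * expR _).
  by field; rewrite sqrt_pi0 !gt_eqF.
by rewrite !exprMn exprVn r2; field; rewrite !gt_eqF.
Qed.

Lemma integral_normal_prob_convolution s t f : 0 < s -> 0 < t ->
  measurable_fun setT f -> (forall x, 0 <= f x)%E ->
  (\int[normal_prob 0 t]_y \int[normal_prob 0 s]_x f (x + y)%R =
   \int[normal_prob 0 (Num.sqrt (s ^+ 2 + t ^+ 2))]_x f x)%E.
Proof.
move=> s0 t0 mf f0; set r := Num.sqrt _.
have mpdf := measurable_normal_pdfE.
have pdf0 m u x : (0 <= (normal_pdf m u x)%:E)%E by rewrite lee_fin normal_pdf_ge0.
pose F yz : \bar R := (f yz.2 * (normal_pdf yz.1 s yz.2)%:E)%E.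
have s_pdf : (fun yz : R * R => (normal_pdf yz.1 s yz.2)%:E) =
    (fun yz => (normal_pdf 0 s (yz.2 - yz.1))%:E).
  by apply/funext => yz; rewrite !normal_pdfE ?gt_eqF// /normal_fun subr0.
have mF : measurable_fun setT F.
  apply: emeasurable_funM; first exact: measurableT_comp mf _.
  rewrite s_pdf; apply: measurableT_comp (mpdf 0 s) _.
  exact: measurable_funB.
have F0 yz : (0 <= F yz)%E by rewrite mule_ge0.
have mFmu := measurable_fun_fubini_tonelli_F (m2 := mu) F mF F0.
transitivity (\int[normal_prob 0 t]_y \int[mu]_z F (y, z))%E.
  apply: eq_integral => y _.
  rewrite (ge0_integral_normal_prob_shift y (lt0r_neq0 s0) mf f0).
  exact: ge0_integral_normal_prob mf f0.
rewrite (ge0_integral_normal_prob _ _ mFmu); last by move=> y; exact: integral_ge0.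
pose G yz := (F yz * (normal_pdf 0 t yz.1)%:E)%E.
have mG : measurable_fun setT G.
  by apply: emeasurable_funM => //; exact: measurableT_comp (mpdf _ _) _.
have G0 yz : (0 <= G yz)%E by rewrite mule_ge0.
transitivity (\int[mu]_y \int[mu]_z G (y, z))%E.
  apply: eq_integral => y _; rewrite -ge0_integralZr//.
  exact: measurableT_comp mF _.
rewrite (@fubini_tonelli _ _ _ _ _ mu mu G mG G0) (ge0_integral_normal_prob _ _ mf f0).
apply: eq_integral => z _; rewrite /G/=.
under eq_integral do rewrite -muleA -EFinM normal_pdf_convolution// EFinM muleA.
rewrite /= ge0_integralZl// ?integral_normal_pdf ?mule1//.
- exact: mpdf.
- by rewrite mule_ge0.
Qed.

Lemma integral_normal_prob_rotate a b f :
  measurable_fun setT f -> (forall x, 0 <= f x)%E ->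
  (\int[normal_prob 0 1]_y \int[normal_prob 0 1]_x f (a * x + b * y)%R =
   \int[normal_prob 0 1]_x f (Num.sqrt (a ^+ 2 + b ^+ 2) * x)%R)%E.
Proof.
move=> mf f0.
have mfD y : measurable_fun setT (fun x => f (x + y)).
  by apply: measurableT_comp => //; exact: measurable_funD.
have [->|a0] := eqVneq a 0.
  rewrite expr0n add0r sqrtr_sqr -ge0_integral_normal_prob_norm//; apply: eq_integral => y _.
  by under eq_integral do rewrite mul0r add0r; rewrite integral_probability_cst.
have [->|b0] := eqVneq b 0.
  under eq_integral => y _ do under eq_integral => x _ do rewrite mul0r addr0.
  by rewrite expr0n addr0 sqrtr_sqr integral_probability_cst -ge0_integral_normal_prob_norm.
have r0 : 0 < a ^+ 2 + b ^+ 2 by rewrite ltr_pwDl ?sqr_ge0// exprn_even_gt0.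
transitivity (\int[normal_prob 0 1]_y \int[normal_prob 0 `|a|]_x f (x + b * y)%R)%E.
  by apply: eq_integral => y _; rewrite (ge0_integral_normal_prob_scale a0 (mfD _)).
have mF : measurable_fun setT (fun yx : R * R => f (yx.2 + yx.1)).
  by apply: measurableT_comp => //; exact: measurable_funD.
have mFa := measurable_fun_fubini_tonelli_F (m2 := normal_prob 0 `|a|) _ mF (fun=> f0 _).
transitivity (\int[normal_prob 0 `|b|]_y \int[normal_prob 0 `|a|]_x f (x + y)%R)%E.
  by apply: (ge0_integral_normal_prob_scale b0 mFa) => y; exact: integral_ge0.
have [na0 nb0] : 0 < `|a| /\ 0 < `|b| by rewrite !normr_gt0.
have norm_sqr (c : R) : `|c| ^+ 2 = c ^+ 2 by rewrite real_normK ?num_real.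
apply: (etrans (integral_normal_prob_convolution na0 nb0 mf f0)).
rewrite (norm_sqr a) (norm_sqr b).
have rn0 : Num.sqrt (a ^+ 2 + b ^+ 2) != 0 by rewrite gt_eqF ?sqrtr_gt0.
by rewrite (ge0_integral_normal_prob_scale rn0 mf f0) ger0_norm ?sqrtr_ge0.
Qed.

End normal_integrals.

(** * Independence *)

Section laws.
Context {R : realType}.
Context {d1 d2 d d' : measure_display} {T1 : measurableType d1} {T2 : measurableType d2}.
Context {S : measurableType d} {S' : measurableType d'}.

Definition same_law (P : {measure set T1 -> \bar R}) (X : T1 -> S)
    (Q : {measure set T2 -> \bar R}) (Y : T2 -> S) : Prop :=
  forall f : S -> \bar R, measurable_fun setT f -> (forall y, 0 <= f y)%E ->
  (\int[P]_w f (X w) = \int[Q]_v f (Y v))%E.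

Definition independent_pair (P : probability T1 R) (X : T1 -> S) (Y : T1 -> S') : Prop :=
  forall F : S * S' -> \bar R, measurable_fun setT F -> (forall z, 0 <= F z)%E ->
  (\int[P]_w F (X w, Y w) = \int[P]_w \int[P]_v F (X w, Y v))%E.

End laws.

Section laws_theory.
Context {R : realType}.

Lemma same_law_comp {d1 d2 d d' : measure_display} {T1 : measurableType d1}
    {T2 : measurableType d2} {S : measurableType d} {S' : measurableType d'}
    (P : {measure set T1 -> \bar R}) (X : T1 -> S)
    (Q : {measure set T2 -> \bar R}) (Y : T2 -> S) (g : S -> S') :
  measurable_fun setT g -> same_law P X Q Y -> same_law P (g \o X) Q (g \o Y).
Proof.
by move=> mg XY f mf f0; apply: (XY (f \o g)) => [|y]; [exact: measurableT_comp mf mg|exact: f0].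
Qed.

Lemma same_law_trans {d1 d2 d3 d : measure_display} {T1 : measurableType d1}
    {T2 : measurableType d2} {T3 : measurableType d3} {S : measurableType d}
    (P1 : {measure set T1 -> \bar R}) (X1 : T1 -> S) (P2 : {measure set T2 -> \bar R})
    (X2 : T2 -> S) (P3 : {measure set T3 -> \bar R}) (X3 : T3 -> S) :
  same_law P1 X1 P2 X2 -> same_law P2 X2 P3 X3 -> same_law P1 X1 P3 X3.
Proof. by move=> X12 X23 f mf f0; rewrite X12// X23. Qed.

Lemma same_law_sym {d1 d2 d : measure_display} {T1 : measurableType d1}
    {T2 : measurableType d2} {S : measurableType d}
    (P : {measure set T1 -> \bar R}) (X : T1 -> S)
    (Q : {measure set T2 -> \bar R}) (Y : T2 -> S) :
  same_law P X Q Y -> same_law Q Y P X.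
Proof. by move=> XY f mf f0; rewrite XY. Qed.

Lemma independent_pair_comp {d d1 d2 d1' d2' : measure_display} {T : measurableType d}
    {S1 : measurableType d1} {S2 : measurableType d2}
    {S1' : measurableType d1'} {S2' : measurableType d2'}
    (P : probability T R) (X : T -> S1) (Y : T -> S2) (g : S1 -> S1') (h : S2 -> S2') :
  measurable_fun setT g -> measurable_fun setT h ->
  independent_pair P X Y -> independent_pair P (g \o X) (h \o Y).
Proof.
move=> mg mh XY F mF F0; apply: (XY (fun z => F (g z.1, h z.2))) => //.
apply: (measurableT_comp mF); apply: measurable_fun_pair.
- exact: measurableT_comp mg _.
- exact: measurableT_comp mh _.
Qed.

Lemma integral_independent_pair {dT d1 d2 dQ1 dQ2 : measure_display}
    {T : measurableType dT} {S1 : measurableType d1} {S2 : measurableType d2}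
    {Q1T : measurableType dQ1} {Q2T : measurableType dQ2}
    (P : probability T R) (X : T -> S1) (Y : T -> S2)
    (Q1 : probability Q1T R) (X' : Q1T -> S1) (Q2 : probability Q2T R) (Y' : Q2T -> S2)
    (F : S1 * S2 -> \bar R) :
  independent_pair P X Y -> same_law P X Q1 X' -> same_law P Y Q2 Y' ->
  measurable_fun setT Y' -> measurable_fun setT F -> (forall z, 0 <= F z)%E ->
  (\int[P]_w F (X w, Y w) = \int[Q1]_x \int[Q2]_y F (X' x, Y' y))%E.
Proof.
move=> indXY XX' YY' mY' mF F0; rewrite indXY//.
transitivity (\int[P]_w \int[Q2]_y F (X w, Y' y))%E.
  apply: eq_integral => w _; apply: (YY' (fun y => F (X w, y))) => //.
  exact: measurableT_comp mF _.
apply: (XX' (fun x => \int[Q2]_y F (x, Y' y))%E) => [|x]; last exact: integral_ge0.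
have mFY' : measurable_fun setT (fun xy : S1 * Q2T => F (xy.1, Y' xy.2)).
  apply: (measurableT_comp mF); apply: measurable_fun_pair => //.
  exact: measurableT_comp mY' _.
exact: (measurable_fun_fubini_tonelli_F (m2 := Q2) _ mFY' (fun=> F0 _)).
Qed.

Lemma same_lawD {d d' : measure_display} {T : measurableType d} {T' : measurableType d'}
    (P : probability T R) (X Y : T -> R) (Q : probability T' R) (X' Y' : T' -> R) :
  measurable_fun setT Y' -> independent_pair P X Y -> independent_pair Q X' Y' ->
  same_law P X Q X' -> same_law P Y Q Y' -> same_law P (X \+ Y) Q (X' \+ Y').
Proof.
move=> mY' indXY indXY' XX' YY' f mf f0.
have mfD : measurable_fun setT (fun z : R * R => f (z.1 + z.2)).
  by apply: (measurableT_comp mf); exact: measurable_funD.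
rewrite [LHS](integral_independent_pair indXY XX' YY' mY' mfD (fun=> f0 _)).
by rewrite -(indXY' (fun z => f (z.1 + z.2)))//.
Qed.

End laws_theory.

Section independent_sigma_algebras.
Context {R : realType} {d : measure_display} {T : measurableType d}.
Variable P : probability T R.
Implicit Types (A B : set T) (G H : set (set T)).

Lemma independent_g_sigma_algebra G B : G `<=` measurable -> setI_closed G ->
  G setT -> measurable B -> (forall A, G A -> P (A `&` B) = P A * P B)%E ->
  forall A, <<s G >> A -> (P (A `&` B) = P A * P B)%E.
Proof.
move=> mG GI GT mB GB A GA.
have PB_fin : P B \is a fin_num by exact: fin_num_measure.
pose PB : {nonneg R} := NngNum (fine_ge0 (measure_ge0 P B)).
have PBE C : mscale PB P C = (P C * P B)%E.
  by rewrite -[LHS]/((fine (P B))%:E * P C)%E fineK// muleC.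
rewrite -PBE.
apply: (@g_sigma_algebra_measure_unique _ R T G mG (fun=> setT) _ _
  (mrestr P mB) (mscale PB P)) => //.
- by rewrite bigcup_const//; exists 0%N.
- by move=> C GC; apply: (etrans (GB C GC)); rewrite -PBE.
- by move=> _; rewrite /mrestr/= (le_lt_trans (probability_le1 P _)) ?ltry// setTI.
Qed.

Lemma independent_g_sigma_algebra2 G H :
  G `<=` measurable -> setI_closed G -> G setT ->
  H `<=` measurable -> setI_closed H -> H setT ->
  (forall A B, G A -> H B -> P (A `&` B) = P A * P B)%E ->
  forall A B, <<s G >> A -> <<s H >> B -> (P (A `&` B) = P A * P B)%E.
Proof.
move=> mG GI GT mH HI HT GH A B GA HB.
have mA : measurable A.
  by move: A GA; apply: smallest_sub mG; exact: sigma_algebra_measurable.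
rewrite setIC muleC; apply: independent_g_sigma_algebra HB => // C HC.
rewrite setIC muleC; apply: independent_g_sigma_algebra GA => // [|D GD].
- exact: mH.
- exact: GH.
Qed.

End independent_sigma_algebras.

Definition cylinder {T : Type} {I : choiceType} {R : realType} (X : I -> T -> R)
    (J : pred I) : set (set T) :=
  [set A | exists (s : seq I) (B : I -> set R),
    [/\ {subset s <= J}, forall i, measurable (B i) &
        A = \bigcap_(i in [set` s]) X i @^-1` B i]].

Section generated.
Context {R : realType} {d : measure_display} {T : measurableType d} {I : choiceType}.
Variable X : I -> T -> R.
Hypothesis mX : forall i, measurable_fun setT (X i).
Implicit Types J K : pred I.

(* The space [T] with the coarser sigma-algebra generated by the [X i], [i \in J]:
   measurability on it expresses dependence on these variables only. *)
Definition generated J := g_sigma_algebraType (cylinder X J).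
HB.instance Definition _ J := Measurable.on (generated J).

Lemma cylinder_measurable J : cylinder X J `<=` measurable.
Proof.
move=> _ [s [B [_ mB ->]]]; rewrite bigcap_seq.
apply: big_ind => //; first exact: measurableI.
by move=> i _; rewrite -[X in measurable X]setTI; exact: mX.
Qed.

Lemma cylinder_setT J : cylinder X J setT.
Proof.
by exists [::], (fun=> setT); split => //; apply/seteqP; split.
Qed.

Lemma cylinder_setI_closed J : setI_closed (cylinder X J).
Proof.
move=> _ _ [s [B [sJ mB ->]]] [t [C [tJ mC ->]]].
exists (s ++ t), (fun i => (if i \in s then B i else setT) `&`
                           (if i \in t then C i else setT)); split.
- by move=> i; rewrite mem_cat => /orP[/sJ|/tJ].
- by move=> i; apply: measurableI; case: ifP.
- apply/seteqP; split => w /=.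
    by move=> [Bw Cw] i _; split; case: ifPn => // i_mem; [exact: Bw|exact: Cw].
  by move=> BCw; split=> i /= i_mem; have := BCw i; rewrite /= mem_cat i_mem ?orbT => -[].
Qed.

Lemma generated_measurable J : measurable_fun setT (id : T -> generated J).
Proof.
move=> _ A mA; rewrite setTI preimage_id; move: A mA.
by apply: smallest_sub (@cylinder_measurable J); exact: sigma_algebra_measurable.
Qed.

Lemma measurable_generated J i : i \in J -> measurable_fun setT (X i : generated J -> R).
Proof.
move=> iJ _ B mB; rewrite setTI; apply: sub_sigma_algebra.
exists [:: i], (fun=> B); split => //.
  by move=> j; rewrite inE => /eqP ->.
by rewrite bigcap_seq big_seq1.
Qed.

Lemma subset_generated J K : {subset J <= K} ->
  measurable_fun setT (id : generated K -> generated J).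
Proof.
move=> JK _ A mA; rewrite setTI preimage_id; move: A mA.
apply: smallest_sub => [|_ [s [B [sJ mB ->]]]]; first exact: sigma_algebra_measurable.
by apply: sub_sigma_algebra; exists s, B; split => // i /sJ /JK.
Qed.

Variable P : probability T R.
Hypothesis indepX : mutually_independent P X.

Lemma probability_bigcap_preimage (s : seq I) (B : I -> set R) :
  (forall i, measurable (B i)) ->
  P (\bigcap_(i in [set` s]) X i @^-1` B i) = (\prod_(i <- undup s) P (X i @^-1` B i))%E.
Proof.
move=> mB; rewrite -(indepX (undup_uniq s) mB) -bigcap_seq; congr (P _).
by apply: eq_bigcapl; split => i /=; rewrite mem_undup.
Qed.

Lemma independent_cylinder J K (A B : set T) : (forall i, i \in J -> i \notin K) ->
  cylinder X J A -> cylinder X K B -> (P (A `&` B) = P A * P B)%E.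
Proof.
move=> JK [s [C [sJ mC ->]]] [t [D [tK mD ->]]].
have st i : i \in s -> i \notin t by move=> /sJ /JK; apply: contra => /tK.
pose E i := if i \in s then C i else D i.
have mE i : measurable (E i) by rewrite /E; case: ifP.
have EC : \bigcap_(i in [set` s]) X i @^-1` C i = \bigcap_(i in [set` s]) X i @^-1` E i.
  by apply: eq_bigcapr => i /= si; rewrite /E si.
have ED : \bigcap_(i in [set` t]) X i @^-1` D i = \bigcap_(i in [set` t]) X i @^-1` E i.
  by apply: eq_bigcapr => i /= ti; rewrite /E ifN//; apply: contraL ti; exact: st.
have -> : \bigcap_(i in [set` s]) X i @^-1` C i `&` \bigcap_(i in [set` t]) X i @^-1` D i =
    \bigcap_(i in [set` s ++ t]) X i @^-1` E i.
  by rewrite EC ED -bigcap_setU; apply: eq_bigcapl; split => i /=; rewrite mem_cat => /orP.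
rewrite EC ED !probability_bigcap_preimage// undup_cat big_cat/=; congr (_ * _)%E.
congr bigop; apply/all_filterP/allP => i; rewrite mem_undup; exact: st.
Qed.

Lemma independent_generated J K (A B : set T) : (forall i, i \in J -> i \notin K) ->
  measurable (A : set (generated J)) -> measurable (B : set (generated K)) ->
  (P (A `&` B) = P A * P B)%E.
Proof.
move=> JK; apply: independent_g_sigma_algebra2.
- exact: cylinder_measurable.
- exact: cylinder_setI_closed.
- exact: cylinder_setT.
- exact: cylinder_measurable.
- exact: cylinder_setI_closed.
- exact: cylinder_setT.
- by move=> C D; exact: independent_cylinder.
Qed.

Lemma independent_pair_generated J K : (forall i, i \in J -> i \notin K) ->
  independent_pair P (id : T -> generated J) (id : T -> generated K).
Proof.
move=> JK F mF F0.
have midJ := @generated_measurable J; have midK := @generated_measurable K.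
have mdiag : measurable_fun setT (fun w : T => (w : generated J, w : generated K)).
  exact: measurable_fun_pair.
pose idJ : {mfun T >-> generated J} := mfun_Sub (mem_set midJ).
pose idK : {mfun T >-> generated K} := mfun_Sub (mem_set midK).
pose diag : {mfun T >-> (generated J * generated K)%type} := mfun_Sub (mem_set mdiag).
have mFK := measurable_fun_fubini_tonelli_F (m2 := distribution P idK) F mF F0.
transitivity (\int[distribution P idJ \x distribution P idK]_z F z)%E.
  rewrite -[LHS]/(\int[P]_w (F \o diag) w)%E -ge0_integral_distribution//.
  apply: eq_measure_integral => A mA _; apply/esym.
  apply: (product_measure_unique (m' := distribution P diag)) => // B C mB mC.
  exact: (independent_generated JK).
rewrite fubini_tonelli1// [LHS](ge0_integral_distribution idJ)//.
  apply: eq_integral => w _; rewrite [LHS](ge0_integral_distribution idK)//.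
  exact: measurableT_comp mF _.
by move=> w; exact: integral_ge0.
Qed.

Lemma independent_pair_of_generated J K {d1 d2 : measure_display}
    {S1 : measurableType d1} {S2 : measurableType d2} (Y : T -> S1) (Z : T -> S2) :
  (forall i, i \in J -> i \notin K) ->
  measurable_fun setT (Y : generated J -> S1) ->
  measurable_fun setT (Z : generated K -> S2) -> independent_pair P Y Z.
Proof.
by move=> JK mY mZ; exact: (independent_pair_comp mY mZ (independent_pair_generated JK)).
Qed.

End generated.

Section mutual_independence.
Context {R : realType} {d : measure_display} {T : measurableType d}.
Variable P : probability T R.

Lemma mutually_independent_comp {I : eqType} (X : I -> T -> R) (h : I -> R -> R) :
  (forall i, measurable_fun setT (h i)) -> mutually_independent P X ->
  mutually_independent P (fun i => h i \o X i).
Proof.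
move=> mh indepX J B uJ mB; apply: (indepX J (fun i => h i @^-1` B i) uJ) => i.
by rewrite -[X in measurable X]setTI; exact: mh.
Qed.

Lemma mutually_independent_groups {I A : choiceType} (X : I -> T -> R)
    (K : A -> pred I) (Y : A -> T -> R) :
  (forall i, measurable_fun setT (X i)) -> mutually_independent P X ->
  (forall a b i, a != b -> i \in K a -> i \notin K b) ->
  (forall a, measurable_fun setT (Y a : generated X (K a) -> R)) ->
  mutually_independent P Y.
Proof.
move=> mX indepX disjK mY J B + mB.
elim: J => [_|a J IH /= /andP[aJ uJ]]; first by rewrite !big_nil probability_setT.
rewrite !big_cons -IH//.
pose KJ := [pred i | has (fun b => i \in K b) J].
apply: (independent_generated mX indepX (J := K a) (K := KJ)).
- move=> i Kai; apply/hasPn => b bJ; apply: disjK Kai.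
  by apply: contraNneq aJ => ->.
- by rewrite -[X in measurable X]setTI; exact: mY.
rewrite big_seq; apply: (@big_ind _ (@measurable _ (generated X KJ))) => //.
  by move=> C D; exact: measurableI.
move=> b bJ; have KbJ : {subset K b <= KJ} by move=> i Kbi; apply/hasP; exists b.
rewrite -[X in measurable X]setTI.
exact: (measurableT_comp (mY b) (subset_generated (X := X) KbJ)).
Qed.

Lemma independent_pair_sum {I : choiceType} (X : I -> T -> R) (i : I) (s : seq I) :
  (forall j, measurable_fun setT (X j)) -> mutually_independent P X -> i \notin s ->
  independent_pair P (X i) (fun w => \sum_(j <- s) X j w).
Proof.
move=> mX indepX si.
apply: (independent_pair_of_generated mX indepX (J := pred1 i) (K := mem s)).
- by move=> j /eqP ->.
- by apply: (measurable_generated (J := pred1 i)); rewrite inE.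
- under eq_fun do rewrite big_seq big_mkcond/=.
  by apply: measurable_sum => j; case: (boolP (j \in s)) => // js;
    exact: (@measurable_generated _ _ _ _ X (mem s)).
Qed.

End mutual_independence.

Lemma same_law_sum {R : realType} {d d' : measure_display} {T : measurableType d}
    {T' : measurableType d'} {I : choiceType} (P : probability T R) (X : I -> T -> R)
    (Q : probability T' R) (Y : I -> T' -> R) (s : seq I) :
  (forall i, measurable_fun setT (X i)) -> (forall i, measurable_fun setT (Y i)) ->
  mutually_independent P X -> mutually_independent Q Y ->
  (forall i, same_law P (X i) Q (Y i)) -> uniq s ->
  same_law P (fun w => \sum_(i <- s) X i w) Q (fun v => \sum_(i <- s) Y i v).
Proof.
move=> mX mY indepX indepY XY; elim: s => [_|i s IH /= /andP[si us]] f mf f0.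
  under eq_integral do rewrite big_nil.
  by under [RHS]eq_integral do rewrite big_nil; rewrite !integral_probability_cst.
under eq_integral do rewrite big_cons; under [RHS]eq_integral do rewrite big_cons.
apply: (same_lawD _ _ _ (XY i) (IH us)) => //; first exact: measurable_sum.
- exact: independent_pair_sum.
- exact: independent_pair_sum.
Qed.

(** * Gaussian variables *)

Section gaussian.
Context {R : realType} {d : measure_display} {T : measurableType d}.
Variable P : probability T R.
Implicit Types (X Y : T -> R) (s t : R).

(* For [s = 0] this is the Dirac mass at [0], unlike [normal_prob 0 0], which is the
   uniform law on [[0, 1]]. *)
Definition gaussian s X : Prop := same_law P X (normal_prob 0 1) ( *%R s).

Lemma same_law_preimage {d' : measure_display} {S : measurableType d'} (X : T -> S)
    (nu : probability S R) : measurable_fun setT X ->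
  (forall B, measurable B -> P (X @^-1` B) = nu B) -> same_law P X nu id.
Proof.
move=> mX lawX f mf f0; pose XRV : {RV P >-> S} := mfun_Sub (mem_set mX).
rewrite -[LHS]/(\int[P]_w (f \o XRV) w)%E -ge0_integral_distribution//.
by apply: eq_measure_integral => B mB _; exact: lawX.
Qed.

Lemma iid_gaussian_gaussian {I : eqType} (X : I -> T -> R) s i : 0 < s ->
  iid_gaussian P X s -> gaussian s (X i).
Proof.
move=> s0 [mX lawX _] f mf f0.
apply: (etrans (same_law_preimage (nu := normal_prob 0 s) (mX i) (lawX i) mf f0)).
by rewrite (ge0_integral_normal_prob_scale (lt0r_neq0 s0) mf f0) gtr0_norm.
Qed.

Lemma gaussianZ s t X : gaussian s X -> gaussian (t * s) (t \*o X).
Proof.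
move=> gX f mf f0; rewrite [LHS](same_law_comp (g := *%R t) _ gX)//.
by under eq_integral do rewrite /= mulrA.
Qed.

Lemma gaussianD s t X Y : independent_pair P X Y ->
  gaussian s X -> gaussian t Y -> gaussian (Num.sqrt (s ^+ 2 + t ^+ 2)) (X \+ Y).
Proof.
move=> indepXY gX gY f mf f0.
have mt : measurable_fun setT ( *%R t) by exact: measurable_funM.
have mfD : measurable_fun setT (fun z : R * R => f (z.1 + z.2)).
  by apply: (measurableT_comp mf); exact: measurable_funD.
rewrite [LHS](integral_independent_pair indepXY gX gY mt mfD (fun=> f0 _)).
rewrite addrC -(integral_normal_prob_rotate t s mf f0).
by apply: eq_integral => x _; apply: eq_integral => y _; rewrite /= addrC.
Qed.

Lemma gaussian_sum {I : choiceType} (X : I -> T -> R) s (c : I -> R) (J : seq I) :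
  0 < s -> iid_gaussian P X s -> uniq J ->
  gaussian (s * Num.sqrt (\sum_(i <- J) c i ^+ 2)) (fun w => \sum_(i <- J) c i * X i w).
Proof.
move=> s0 iidX; have [mX _ indepX] := iidX.
have mc i : measurable_fun setT ( *%R (c i)) by exact: measurable_funM.
elim: J => [_|i J IH /= /andP[iJ uJ]].
  move=> f mf f0; under eq_integral do rewrite big_nil.
  under [RHS]eq_integral do rewrite big_nil sqrtr0 mulr0 mul0r.
  by rewrite !integral_probability_cst.
have indep_cX : independent_pair P (c i \*o X i) (fun w => \sum_(j <- J) c j * X j w).
  apply: (independent_pair_sum (X := fun j => c j \*o X j) _ _ iJ).
    by move=> j; exact: measurableT_comp (mc j) (mX j).
  exact: mutually_independent_comp mc indepX.
have gcX : gaussian (c i * s) (c i \*o X i) by apply/gaussianZ/iid_gaussian_gaussian.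
rewrite big_cons (_ : (fun w => \sum_(j <- i :: J) c j * X j w) =
  (c i \*o X i) \+ (fun w => \sum_(j <- J) c j * X j w)); last first.
  by apply/funext => w; rewrite big_cons.
have -> : s * Num.sqrt (c i ^+ 2 + \sum_(j <- J) c j ^+ 2) =
    Num.sqrt ((c i * s) ^+ 2 + (s * Num.sqrt (\sum_(j <- J) c j ^+ 2)) ^+ 2).
  rewrite !exprMn sqr_sqrtr ?sumr_ge0// => [|j _]; last exact: sqr_ge0.
  by rewrite mulrC (mulrC (s ^+ 2)) -mulrDl sqrtrM ?addr_ge0 ?sumr_ge0 ?sqr_ge0//
    ?sqrtr_sqr ?gtr0_norm// => j _; exact: sqr_ge0.
exact: gaussianD indep_cX gcX (IH uJ).
Qed.

End gaussian.

(** * One layer of the network *)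

Section activation.
Context {R : realType}.
Implicit Types (a c z : R).

Lemma measurable_sqrt : measurable_fun setT (@Num.sqrt R).
Proof. exact: (continuous_measurable_fun (@sqrt_continuous R)). Qed.

Lemma measurable_prelu a : measurable_fun setT (prelu a).
Proof.
apply: measurable_fun_ifT; [exact: measurable_fun_ltr|exact: measurable_id|].
exact: measurable_funM.
Qed.

Lemma measurable_prelu_sqr a : measurable_fun setT (fun z => prelu a z ^+ 2).
Proof. by apply: measurable_funX; exact: measurable_prelu. Qed.

Lemma preluM a c z : 0 <= c -> prelu a (c * z) = c * prelu a z.
Proof.
rewrite le_eqVlt => /predU1P[<-|c0]; first by rewrite !mul0r /prelu ltxx mulr0.
by rewrite /prelu pmulr_rgt0//; case: ifP => // _; rewrite mulrCA.
Qed.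

Lemma normr_prelu_ge a z : 0 <= a <= 1 -> a * `|z| <= `|prelu a z|.
Proof.
move=> /andP[a0 a1]; rewrite /prelu; case: ifPn => _.
- by rewrite ler_piMl.
- by rewrite normrM (ger0_norm a0).
Qed.

Lemma normr_prelu_le a z : 0 <= a <= 1 -> `|prelu a z| <= `|z|.
Proof.
move=> /andP[a0 a1]; rewrite /prelu; case: ifPn => // _.
by rewrite normrM (ger0_norm a0) ler_piMl.
Qed.

Section enorm.
Context {d : nat}.
Implicit Types x : 'cV[R]_d.

Lemma enorm_ge0 x : 0 <= enorm x.
Proof. exact: sqrtr_ge0. Qed.

Lemma sqr_enorm x : enorm x ^+ 2 = \sum_i x i 0 ^+ 2.
Proof. by rewrite sqr_sqrtr// sumr_ge0// => i _; exact: sqr_ge0. Qed.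

Lemma enorm_gt0 x : x != 0 -> 0 < enorm x.
Proof.
rewrite lt_def enorm_ge0 andbT; apply: contra_neq => x0; apply/matrixP => i j.
have /eqP := sqr_enorm x; rewrite x0 expr0n eq_sym psumr_eq0 => [|k _]; last exact: sqr_ge0.
by move=> /allP/(_ i (mem_index_enum _)); rewrite sqrf_eq0 ord1 mxE => /eqP.
Qed.

Lemma normr_le_enorm x i : `|x i 0| <= enorm x.
Proof.
rewrite -ler_sqr ?nnegrE ?enorm_ge0// real_normK ?num_real// sqr_enorm.
by rewrite (bigD1 i)//= lerDl sumr_ge0// => j _; exact: sqr_ge0.
Qed.

Lemma enorm_le_sum x : enorm x <= \sum_i `|x i 0|.
Proof.
have sum_ge0 : 0 <= \sum_i `|x i 0| by apply: sumr_ge0.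
rewrite -ler_sqr ?nnegrE ?enorm_ge0// sqr_enorm expr2 mulr_suml.
apply: ler_sum => i _; rewrite -[leLHS]real_normK ?num_real// expr2.
by rewrite ler_wpM2l// (bigD1 i)//= lerDl sumr_ge0.
Qed.

Lemma enormZ c x : 0 <= c -> enorm (c *: x) = c * enorm x.
Proof.
move=> c0; rewrite /enorm; under eq_bigr do rewrite mxE exprMn.
by rewrite -mulr_sumr sqrtrM ?sqr_ge0// sqrtr_sqr ger0_norm.
Qed.

Lemma prelu_vecZ a c x : 0 <= c -> prelu_vec a (c *: x) = c *: prelu_vec a x.
Proof. by move=> c0; apply/matrixP => i j; rewrite !mxE preluM. Qed.

Lemma enorm_prelu_vec a x : enorm (prelu_vec a x) = Num.sqrt (\sum_i prelu a (x i 0) ^+ 2).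
Proof. by congr Num.sqrt; apply: eq_bigr => i _; rewrite mxE. Qed.

Lemma measurable_enorm_prelu_vec {dS : measure_display} {S : measurableType dS} a
    (x : S -> 'cV[R]_d) : (forall i, measurable_fun setT (fun t => x t i 0)) ->
  measurable_fun setT (fun t => enorm (prelu_vec a (x t))).
Proof.
move=> mx; under eq_fun do rewrite enorm_prelu_vec.
apply: (measurableT_comp measurable_sqrt); apply: measurable_sum => i.
exact: (measurableT_comp (measurable_prelu_sqr a) (mx i)).
Qed.

End enorm.

Definition gain a {d : nat} {T : Type} (Z : 'I_d -> T -> R) (w : T) : R :=
  enorm (prelu_vec a (\col_i Z i w)).

Lemma gain_ge0 a {d : nat} {T : Type} (Z : 'I_d -> T -> R) w : 0 <= gain a Z w.
Proof. exact: enorm_ge0. Qed.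

Lemma measurable_gain a {d : nat} {dT : measure_display} {T : measurableType dT}
    (Z : 'I_d -> T -> R) :
  (forall i, measurable_fun setT (Z i)) -> measurable_fun setT (gain a Z).
Proof.
move=> mZ; apply: measurable_enorm_prelu_vec => i.
by under eq_fun do rewrite mxE; exact: mZ.
Qed.

End activation.

Definition weight {R : realType} {d : nat} {T : Type} (W : nat -> T -> 'M[R]_d)
    (t : nat * 'I_d * 'I_d) (w : T) : R :=
  W t.1.1 w t.1.2 t.2.

Section layers.
Context {R : realType} {dT : measure_display} {T : measurableType dT}.
Variables (P : probability T R) (d : nat) (a sigma : R).
Variables (W : nat -> T -> 'M[R]_d) (Z : 'I_d -> T -> R).

Hypotheses (sigma0 : 0 < sigma) (iidW : iid_gaussian P (weight W) sigma).
Hypothesis iidZ : iid_gaussian P Z 1.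

Let mW : forall t, measurable_fun setT (weight W t). Proof. by have [] := iidW. Qed.
Let indepW : mutually_independent P (weight W). Proof. by have [] := iidW. Qed.
Let mZ : forall i, measurable_fun setT (Z i). Proof. by have [] := iidZ. Qed.
Let indepZ : mutually_independent P Z. Proof. by have [] := iidZ. Qed.

Let row k i : pred (nat * 'I_d * 'I_d) := [pred t | t.1 == (k, i)].
Let before k : pred (nat * 'I_d * 'I_d) := [pred t | (t.1.1 < k)%N].
Let layer k : pred (nat * 'I_d * 'I_d) := [pred t | t.1.1 == k].

Lemma gaussian_row (x : 'cV[R]_d) k i :
  gaussian P (sigma * enorm x) (fun w => (W k w *m x) i 0).
Proof.
pose J := [seq (k, i, j) | j <- index_enum 'I_d].
have uJ : uniq J by rewrite map_inj_uniq ?index_enum_uniq// => j j' [].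
have := gaussian_sum (fun t => x t.2 0) sigma0 iidW uJ; rewrite big_map.
congr (gaussian P _ _); apply/funext => w; rewrite big_map mxE.
by apply: eq_bigr => j _; rewrite mulrC.
Qed.

Lemma mutually_independent_rows (x : 'cV[R]_d) k :
  mutually_independent P (fun i w => (W k w *m x) i 0).
Proof.
apply: (mutually_independent_groups (K := row k) mW indepW).
  by move=> i j t ij /eqP tki; rewrite inE tki; apply: contra_neq ij => -[].
move=> i; under eq_fun do rewrite mxE.
apply: measurable_sum => j; apply: measurable_funM => //.
by apply: (@measurable_generated _ _ _ _ (weight W) (row k i) (k, i, j)); rewrite inE.
Qed.

Lemma same_law_layer (x : 'cV[R]_d) k :
  same_law P (fun w => enorm (prelu_vec a (W k w *m x)))
           P (fun v => sigma * enorm x * gain a Z v).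
Proof.
have mM c : measurable_fun setT ( *%R c : R -> R) by exact: measurable_funM.
have mp := measurable_prelu_sqr a.
have mrow i : measurable_fun setT (fun w => (W k w *m x) i 0).
  under eq_fun do rewrite mxE; apply: measurable_sum => j.
  by apply: measurable_funM => //; exact: (mW (k, i, j)).
pose c := sigma * enorm x; have c0 : 0 <= c by rewrite mulr_ge0 ?enorm_ge0// ltW.
have same_row i : same_law P (fun w => (W k w *m x) i 0) P (c \*o Z i).
  apply: same_law_trans (gaussian_row x k i) _; apply: same_law_sym.
  rewrite -[sigma * enorm x]mulr1; apply: gaussianZ.
  exact: iid_gaussian_gaussian ltr01 iidZ.
have same_sum := same_law_sum
  (fun i => measurableT_comp mp (mrow i))
  (fun i => measurableT_comp mp (measurableT_comp (mM c) (mZ i)))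
  (mutually_independent_comp (fun=> mp) (mutually_independent_rows x k))
  (mutually_independent_comp (fun=> measurableT_comp mp (mM c)) indepZ)
  (fun i => same_law_comp mp (same_row i)) (index_enum_uniq 'I_d).
move=> f mf f0; have := same_law_comp measurable_sqrt same_sum mf f0.
congr (_ = _); apply: eq_integral => w _; congr f.
  by rewrite enorm_prelu_vec.
rewrite /gain -/c -enormZ// -prelu_vecZ// enorm_prelu_vec; congr Num.sqrt.
by apply: eq_bigr => i _; rewrite !mxE.
Qed.

Variable x0 : 'cV[R]_d.

Lemma measurable_layers k i :
  measurable_fun setT ((fun w => layers a x0 W k w i 0) : generated (weight W) (before k) -> R).
Proof.
elim: k i => [|k IH] i; first exact: measurable_cst.
under eq_fun do rewrite /= !mxE.
apply: (measurableT_comp (measurable_prelu a)); apply: measurable_sum => j.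
apply: measurable_funM.
  apply: (@measurable_generated _ _ _ _ (weight W) (before k.+1) (k, i, j)).
  by rewrite inE/=.
apply: (measurableT_comp (IH j)); apply: subset_generated => t.
by rewrite !inE => /ltn_trans; apply.
Qed.

Lemma measurable_enorm_layers k : measurable_fun setT (fun w => enorm (layers a x0 W k w)).
Proof.
have mid := generated_measurable mW (J := before k).
apply: (measurableT_comp measurable_sqrt); apply: measurable_sum => i.
by apply: measurable_funX; exact: (measurableT_comp (@measurable_layers k i) mid).
Qed.

Lemma integral_enorm_layersS k (f : R -> \bar R) :
  measurable_fun setT f -> (forall x, 0 <= f x)%E ->
  (\int[P]_w f (enorm (layers a x0 W k.+1 w)) =
   \int[P]_w \int[P]_v f (sigma * enorm (layers a x0 W k w) * gain a Z v)%R)%E.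
Proof.
move=> mf f0.
pose F (z : generated (weight W) (before k) * generated (weight W) (layer k)) :=
  f (enorm (prelu_vec a (W k z.2 *m layers a x0 W k z.1))).
have mF : measurable_fun setT F.
  apply: (measurableT_comp mf); apply: measurable_enorm_prelu_vec => i.
  under eq_fun do rewrite mxE; apply: measurable_sum => j; apply: measurable_funM.
    have mij : measurable_fun setT (weight W (k, i, j) : generated (weight W) (layer k) -> R).
      by apply: measurable_generated; rewrite inE.
    exact: measurableT_comp mij measurable_snd.
  exact: (measurableT_comp (@measurable_layers k j) measurable_fst).
have disj t : t \in before k -> t \notin layer k.
  by rewrite !inE; case: ltngtP.
rewrite [LHS](independent_pair_generated mW indepW disj mF (fun=> f0 _)).
by apply: eq_integral => w _; exact: (same_law_layer (layers a x0 W k w) k mf f0).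
Qed.

End layers.

(** * Multiplicative functionals of the layers *)

Section almost_sure_decay.
Context {R : realType} {d : measure_display} {T : measurableType d}.

Lemma nneseries_geometric_lty (c r : R) : `|r| < 1 ->
  (\sum_(0 <= k <oo) (c * r ^+ k)%:E < +oo)%E.
Proof.
move=> r1; suff -> : (\sum_(0 <= k <oo) (c * r ^+ k)%:E = (c / (1 - r))%:E)%E.
  by rewrite ltry.
apply/cvg_lim => //.
rewrite (_ : (fun n : nat => _) = EFin \o series (geometric c r)); last first.
  by apply/funext => n /=; rewrite -sumEFin.
by apply: cvg_EFin; [exact: nearW|exact: cvg_geometric_series].
Qed.

Lemma ae_cvg0_of_nneseries_integral_lty (mu : {measure set T -> \bar R}) (f : nat -> T -> R) :
  (forall k, measurable_fun setT (f k)) -> (forall k w, 0 <= f k w) ->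
  (\sum_(0 <= k <oo) \int[mu]_w (f k w)%:E < +oo)%E ->
  {ae mu, forall w, f k w @[k --> \oo] --> 0}.
Proof.
move=> mf f0 sum_lty.
have mfE k : measurable_fun setT (fun w => (f k w)%:E) by exact/measurable_EFinP.
have sum_ge0 w : (0 <= \sum_(0 <= k <oo) (f k w)%:E)%E.
  by apply: nneseries_ge0 => k _ _; rewrite lee_fin.
have int_sum : mu.-integrable setT (fun w => \sum_(0 <= k <oo) (f k w)%:E)%E.
  apply/integrableP; split.
    by apply: ge0_emeasurable_sum => // k w _ _; rewrite lee_fin.
  under eq_integral do rewrite (gee0_abs (sum_ge0 _)).
  by rewrite integral_nneseries// => k w _; rewrite lee_fin.
have := integrable_ae measurableT int_sum; apply: filterS => w /(_ I) sum_fin.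
apply: (@cvg_series_cvg_0 _ R^o); apply: nnseries_is_cvg => //.
by rewrite ltey_eq sum_fin.
Qed.

Lemma ae_of_probability1 (P : probability T R) (A : set T) :
  measurable A -> P A = 1%E -> {ae P, forall w, A w}.
Proof.
move=> mA PA; exists (~` A); split => //; first exact: measurableC.
by rewrite probability_setC// PA subee.
Qed.

End almost_sure_decay.

Section nonzero_indicator.
Context {R : realType}.

Definition nonzero (u : R) : R := (u != 0)%:R.

Lemma nonzeroM x y : nonzero (x * y) = nonzero x * nonzero y.
Proof. by rewrite /nonzero mulf_eq0 negb_or -natrM mulnb. Qed.

Lemma nonzero_ge0 x : 0 <= nonzero x.
Proof. exact: ler0n. Qed.

Lemma nonzero_indic : nonzero = \1_(~` [set 0]).
Proof.
apply/funext => u; rewrite /nonzero indicE; congr (nat_of_bool _)%:R.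
by apply/idP/idP => [/eqP u0|/set_mem/eqP//]; exact/mem_set.
Qed.

Lemma measurable_nonzero : measurable_fun setT nonzero.
Proof. by rewrite nonzero_indic; apply: measurable_indic; exact: measurableC. Qed.

Lemma measurable_neq0 {d : measure_display} {T : measurableType d} (f : T -> R) :
  measurable_fun setT f -> measurable [set w | f w != 0].
Proof.
move=> mf; rewrite (_ : [set w | _] = f @^-1` (~` [set 0])); last first.
  by apply/seteqP; split => w /= /eqP.
by rewrite -[X in measurable X]setTI; apply: mf => //; exact: measurableC.
Qed.

Lemma integral_nonzero {d : measure_display} {T : measurableType d}
    (P : probability T R) (f : T -> R) : measurable_fun setT f ->
  (\int[P]_w (nonzero (f w))%:E = P [set w | (f w != 0)%R])%E.
Proof.
move=> mf; rewrite -[X in P X]setIT -integral_indic//; last exact: measurable_neq0.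
by apply: eq_integral => w _; rewrite /nonzero indicE mem_setE.
Qed.

Lemma cvg0_of_nonzero (u : R^nat) : nonzero (u k) @[k --> \oo] --> 0 -> u @ \oo --> 0.
Proof.
move=> /cvgrPdist_lt/(_ 1 ltr01) nonzero_u; apply/cvgrPdist_lt => e e0.
apply: filterS nonzero_u => k; rewrite /nonzero !sub0r !normrN normr_nat.
by rewrite ltrn1; have [->|] := eqVneq (u k) 0; rewrite ?normr0.
Qed.

End nonzero_indicator.

Section multiplicative.
Context {R : realType} {dT : measure_display} {T : measurableType dT}.
Variables (P : probability T R) (d : nat) (a sigma : R) (x0 : 'cV[R]_d).
Variables (W : nat -> T -> 'M[R]_d) (Z : 'I_d -> T -> R).
Hypothesis sigma0 : 0 < sigma.
Hypothesis iidW : iid_gaussian P (weight W) sigma.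
Hypothesis iidZ : iid_gaussian P Z 1.

Let norm_layer k w := enorm (layers a x0 W k w).

Let mnorm k : measurable_fun setT (norm_layer k).
Proof. exact: measurable_enorm_layers iidW _ _. Qed.

Let mgain : measurable_fun setT (gain a Z).
Proof. by apply: measurable_gain; have [] := iidZ. Qed.

Section multiplicative_functional.
Variables (g : R -> R) (r : R).
Hypotheses (mg : measurable_fun setT g) (g0 : forall x, 0 <= g x).
Hypothesis gM : forall x y, 0 <= x -> 0 <= y -> g (x * y) = g x * g y.
Hypothesis intg : (\int[P]_v (g (sigma * gain a Z v))%:E = r%:E)%E.

Let mgE : measurable_fun setT (EFin \o g). Proof. exact/measurable_EFinP. Qed.
Let gE0 x : (0 <= (EFin \o g) x)%E. Proof. by rewrite lee_fin. Qed.

Lemma integral_multiplicative_layers k :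
  (\int[P]_w (g (norm_layer k w))%:E = (g (enorm x0) * r ^+ k)%:E)%E.
Proof.
elim: k => [|k IH]; first by rewrite /norm_layer/= integral_probability_cst expr0 mulr1.
rewrite (integral_enorm_layersS a sigma0 iidW iidZ x0 k mgE gE0).
transitivity (\int[P]_w ((g (norm_layer k w))%:E * r%:E))%E.
  apply: eq_integral => w _; rewrite -intg -ge0_integralZl//.
  - apply: eq_integral => v _ /=; rewrite -EFinM -gM ?enorm_ge0//.
      by rewrite mulrA (mulrC _ sigma).
    by rewrite mulr_ge0 ?gain_ge0// ltW.
  - by apply: (measurableT_comp mgE); exact: measurable_funM.
  - by move=> v _; exact: gE0.
  - exact: gE0.
rewrite ge0_integralZr//.
- by rewrite IH -EFinM exprSr mulrA.
- exact: measurableT_comp mgE (mnorm k).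
- by move=> v _; exact: gE0.
- by rewrite -intg; apply: integral_ge0 => v _; exact: gE0.
Qed.

Lemma ae_multiplicative_layers_cvg0 : r < 1 ->
  {ae P, forall w, g (norm_layer k w) @[k --> \oo] --> 0}.
Proof.
move=> r1; apply: ae_cvg0_of_nneseries_integral_lty => // [k|].
  exact: measurableT_comp mg (mnorm k).
under eq_eseriesr do rewrite integral_multiplicative_layers.
apply: nneseries_geometric_lty; rewrite ger0_norm// -lee_fin -intg.
by apply: integral_ge0 => v _; exact: gE0.
Qed.

End multiplicative_functional.

Let integral_nonzero_gain :
  (\int[P]_v (nonzero (sigma * gain a Z v))%:E = (fine (P [set v | gain a Z v != 0%R]))%:E)%E.
Proof.
rewrite integral_nonzero; last exact: measurable_funM.
rewrite fineK ?fin_num_measure//; last exact: measurable_neq0.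
by congr (P _); apply/seteqP; split => v /=; rewrite mulf_eq0 (gt_eqF sigma0).
Qed.

Lemma ae_layers_cvg0_of_gain_eq0 : (P [set v | gain a Z v != 0%R] < 1)%E ->
  {ae P, forall w, norm_layer k w @[k --> \oo] --> 0}.
Proof.
move=> PV; have PV1 : fine (P [set v | gain a Z v != 0]) < 1.
  by rewrite -lte_fin fineK// fin_num_measure//; exact: measurable_neq0.
have := ae_multiplicative_layers_cvg0 measurable_nonzero nonzero_ge0
  (fun x y _ _ => nonzeroM x y) integral_nonzero_gain PV1.
by apply: filterS => w; exact: cvg0_of_nonzero.
Qed.

Lemma ae_layers_gt0 : x0 != 0 -> P [set v | gain a Z v != 0%R] = 1%E ->
  {ae P, forall w, forall k, 0 < norm_layer k w}.
Proof.
move=> x0_neq0 PV; apply: ae_foralln => k.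
have Pk : P [set w | norm_layer k w != 0] = 1%E.
  rewrite -integral_nonzero// (integral_multiplicative_layers measurable_nonzero nonzero_ge0
    (fun x y _ _ => nonzeroM x y) integral_nonzero_gain).
  by rewrite PV /= expr1n mulr1 /nonzero gt_eqF// enorm_gt0.
have := ae_of_probability1 (measurable_neq0 (mnorm k)) Pk.
by apply: filterS => w /= xw; rewrite lt_def xw enorm_ge0.
Qed.

End multiplicative.

(** * Moment generating functions *)

Section exponential_bounds.
Context {R : realType}.
Implicit Types x y t u v e : R.

Lemma expR_le_between u t v y : u <= t <= v -> expR (t * y) <= expR (u * y) + expR (v * y).
Proof.
move=> /andP[ut tv]; have [y0|/ltW y0] := leP 0 y.
- by rewrite ler_wpDl ?expR_ge0// ler_expR ler_wpM2r.
- by rewrite ler_wpDr ?expR_ge0// ler_expR ler_wnM2r.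
Qed.

Lemma normr_mul_expR_le e t y : 0 < e ->
  `|y * expR (t * y)| <= e^-1 * (expR ((t - e) * y) + expR ((t + e) * y)).
Proof.
move=> e0; rewrite -ler_pdivrMl ?invr_gt0// invrK normrM (ger0_norm (expR_ge0 _)) mulrA.
rewrite -[e in leLHS]gtr0_norm// -normrM.
have norm_le (z : R) : `|z| <= expR (- z) + expR z.
  have [? ?] := (expR_ge1Dx z, expR_ge1Dx (- z)).
  by have [? ?] := (expR_ge0 z, expR_ge0 (- z)); case: ger0P => _; lra.
apply: (@le_trans _ _ ((expR (- (e * y)) + expR (e * y)) * expR (t * y))).
  by rewrite ler_wpM2r ?expR_ge0.
rewrite mulrDl -!expRD (_ : - (e * y) + t * y = (t - e) * y); last by ring.
by rewrite (_ : e * y + t * y = (t + e) * y)//; ring.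
Qed.

Lemma is_derive_expRM y t : is_derive t 1 (fun u => expR (u * y)) (y * expR (t * y)).
Proof.
have -> : (fun u => expR (u * y)) = expR \o *%R^~ y by [].
rewrite mulrC; apply: is_derive1_comp.
by apply: is_derive_eq; rewrite /GRing.scale/= mulr0 add0r mulr1.
Qed.

Lemma mul_max0_le_expR t y : 0 <= t -> t * Num.max 0 y <= expR (t * y).
Proof.
move=> t0; have [? ?] := (expR_ge1Dx (t * y), expR_ge0 (t * y)).
by case: (leP 0 y) => _; [lra|rewrite mulr0].
Qed.

End exponential_bounds.

Section real_integrals.
Context {R : realType} {d : measure_display} {T : measurableType d}.
Variable mu : {measure set T -> \bar R}.
Implicit Types f g : T -> R.

Lemma dominated_integrable f g : measurable_fun setT f ->
  (forall w, `|f w| <= g w) -> mu.-integrable setT (EFin \o g) ->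
  mu.-integrable setT (EFin \o f).
Proof.
move=> mf fg; apply: le_integrable => //; first exact/measurable_EFinP.
by move=> w _; rewrite /= lee_fin (le_trans (fg w))// ler_norm.
Qed.

Lemma integrable_EFinD f g : mu.-integrable setT (EFin \o f) ->
  mu.-integrable setT (EFin \o g) -> mu.-integrable setT (EFin \o (fun w => f w + g w)).
Proof. exact: integrableD. Qed.

Lemma integrable_EFinZl (k : R) f : mu.-integrable setT (EFin \o f) ->
  mu.-integrable setT (EFin \o (fun w => k * f w)).
Proof. exact: integrableZl. Qed.

Lemma RintegralN f : mu.-integrable setT (EFin \o f) ->
  \int[mu]_w (- f w) = - \int[mu]_w f w.
Proof.
move=> intf; rewrite -mulN1r -RintegralZl//.
by apply: eq_Rintegral => w _; rewrite mulN1r.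
Qed.

Lemma measurable_lt_fun f g : measurable_fun setT f -> measurable_fun setT g ->
  measurable [set w | f w < g w].
Proof.
move=> mf mg; rewrite -[X in measurable X]setTI.
exact: (measurable_fun_ltr mf mg measurableT (Y := [set true])).
Qed.

Lemma Rintegral_gt0 f : mu.-integrable setT (EFin \o f) -> (forall w, 0 <= f w) ->
  (0 < mu [set w | (0 < f w)%R])%E -> 0 < \int[mu]_w f w.
Proof.
move=> intf f0; apply: contraTT; rewrite -leNgt => int_le0.
have mf : measurable_fun setT f by apply/measurable_EFinP; exact: measurable_int intf.
have int_abs0 : (\int[mu]_w `|(EFin \o f) w| = 0)%E.
  rewrite (eq_integral (EFin \o f)) => [|w _]; last by rewrite gee0_abs// lee_fin.
  rewrite -[LHS]fineK; last exact: integrable_fin_num intf.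
  by congr _%:E; apply/eqP; rewrite eq_le int_le0 Rintegral_ge0.
have /(ae_eq_integral_abs mu measurableT)[ae_f0 _] : measurable_fun setT (EFin \o f).
  exact/measurable_EFinP.
rewrite -leNgt (measure_negligible _ (negligibleS _ (ae_f0 int_abs0)))//.
  exact: measurable_lt_fun.
move=> w /= fw; apply/not_implyP; split => // -[fw0].
by rewrite fw0 ltxx in fw.
Qed.

Lemma lt_Rintegral f g : mu.-integrable setT (EFin \o f) ->
  mu.-integrable setT (EFin \o g) -> (forall w, f w <= g w) ->
  (0 < mu [set w | (f w < g w)%R])%E -> \int[mu]_w f w < \int[mu]_w g w.
Proof.
move=> intf intg fg mu_fg; rewrite -subr_gt0 -RintegralB//.
apply: Rintegral_gt0 => [|w|]; first exact: (integrableB measurableT intg intf).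
  by rewrite subr_ge0.
by under eq_set do rewrite subr_gt0.
Qed.

End real_integrals.

Section mgf.
Context {R : realType} {d : measure_display} {T : measurableType d}.
Variable P : probability T R.
Implicit Types (Y : T -> R) (s t u v : R).

Definition mgf Y t : R := \int[P]_w expR (t * Y w).

Definition exp_integrable Y t : Prop :=
  P.-integrable setT (EFin \o (fun w => expR (t * Y w))).

Lemma integrable_probability_cst (c : R) : P.-integrable setT (EFin \o (fun=> c)).
Proof. exact: finite_measure_integrable_cst. Qed.

Lemma Rintegral_probability_cst (c : R) : \int[P]_w c = c.
Proof. by rewrite /Rintegral integral_probability_cst. Qed.

Lemma mgf0 Y : mgf Y 0 = 1.
Proof.
rewrite -[RHS]Rintegral_probability_cst; apply: eq_Rintegral => w _.
by rewrite mul0r expR0.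
Qed.

Lemma mgf_ge0 Y t : 0 <= mgf Y t.
Proof. by apply: Rintegral_ge0 => w _; exact: expR_ge0. Qed.

Lemma mgfN Y t : mgf (\- Y) t = mgf Y (- t).
Proof. by apply: eq_Rintegral => w _; rewrite mulrN mulNr. Qed.

Lemma exp_integrableN Y t : exp_integrable (\- Y) t <-> exp_integrable Y (- t).
Proof.
rewrite /exp_integrable; suff -> : (fun w => expR (t * (\- Y) w)) =
  (fun w => expR (- t * Y w)) by [].
by apply/funext => w; rewrite mulrN mulNr.
Qed.

Lemma measurable_expRM Y t : measurable_fun setT Y ->
  measurable_fun setT (fun w => expR (t * Y w)).
Proof. by move=> mY; apply: measurableT_comp => //; exact: measurable_funM. Qed.

Section between.
Variables (Y : T -> R) (u v : R).
Hypothesis mY : measurable_fun setT Y.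
Hypotheses (intu : exp_integrable Y u) (intv : exp_integrable Y v).

Lemma exp_integrable_between t : u <= t <= v -> exp_integrable Y t.
Proof.
move=> utv; apply: (dominated_integrable (measurable_expRM t mY) _ (integrable_EFinD intu intv)).
by move=> w; rewrite ger0_norm ?expR_ge0// expR_le_between.
Qed.

Let envelope (e : R) w : R := e^-1 * (2 * (expR (u * Y w) + expR (v * Y w))).

Lemma normr_mul_expR_le_between e t w : 0 < e -> u <= t - e -> t + e <= v ->
  `|Y w * expR (t * Y w)| <= envelope e w.
Proof.
move=> e0 ute tev; apply: le_trans (normr_mul_expR_le t (Y w) e0) _.
rewrite ler_wpM2l ?invr_ge0 ?(ltW e0)// mulr_natl mulr2n lerD// expR_le_between//; lra.
Qed.

Let integrable_envelope e :
  P.-integrable setT (EFin \o envelope e).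
Proof. by do 2!apply: integrable_EFinZl; exact: integrable_EFinD. Qed.

Lemma integrable_mul_expR t : u < t < v ->
  P.-integrable setT (EFin \o (fun w => Y w * expR (t * Y w))).
Proof.
move=> /andP[ut tv]; pose e := Num.min (t - u) (v - t).
have e0 : 0 < e by rewrite lt_min !subr_gt0 ut.
apply: (dominated_integrable _ _ (integrable_envelope e)) => [|w].
  by apply: measurable_funM => //; exact: measurable_expRM.
have [etu etv] : e <= t - u /\ e <= v - t by rewrite !ge_min !lexx orbT.
by apply: normr_mul_expR_le_between => //; lra.
Qed.

Lemma is_derive_mgf t : u < t < v -> is_derive t 1 (mgf Y) (\int[P]_w (Y w * expR (t * Y w))).
Proof.
move=> /andP[ut tv]; pose e := Num.min ((t - u) / 2) ((v - t) / 2).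
have e0 : 0 < e by rewrite lt_min !divr_gt0 ?subr_gt0.
have [etu etv] : e <= (t - u) / 2 /\ e <= (v - t) / 2 by rewrite !ge_min !lexx orbT.
have near_uv x : `]t - e, t + e[%classic x -> u <= x - e /\ x + e <= v.
  by rewrite /= in_itv/= => /andP[? ?]; lra.
have t_near : `]t - e, t + e[%classic t by rewrite /= in_itv/=; lra.
have int_near x : `]t - e, t + e[%classic x -> exp_integrable Y x.
  by move=> /near_uv[? ?]; apply: exp_integrable_between; lra.
have deriv x w : derivable (fun s => expR (s * Y w)) x 1 by case: (is_derive_expRM (Y w) x).
have partialE x w : partial1of2 (fun s w => expR (s * Y w)) x w = Y w * expR (x * Y w).
  by rewrite partial1of2E; have [_ ->] := is_derive_expRM (Y w) x.
have envelope_ge0 w : 0 <= envelope e w.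
  by rewrite !mulr_ge0 ?invr_ge0 ?ltW ?addr_gt0 ?expR_gt0.
have derivative_bound x w : `]t - e, t + e[%classic x -> setT w ->
    `|partial1of2 (fun s w => expR (s * Y w)) x w| <= envelope e w.
  by move=> /near_uv[? ?] _; rewrite partialE normr_mul_expR_le_between.
split.
- exact: (derivable_under_integral measurableT t_near int_near (fun x w _ _ => deriv x w)
    envelope_ge0 (integrable_envelope e) derivative_bound).
- rewrite -derive1E (differentiation_under_integral measurableT t_near int_near
    (fun x w _ _ => deriv x w) envelope_ge0 (integrable_envelope e) derivative_bound).
  by apply: eq_Rintegral => w _.
Qed.

End between.

Section around0.
Variables (Y : T -> R) (u v : R).
Hypotheses (u0 : u < 0) (v0 : 0 < v) (mY : measurable_fun setT Y).
Hypotheses (intu : exp_integrable Y u) (intv : exp_integrable Y v).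

Lemma integrable_of_exp_integrable : P.-integrable setT (EFin \o Y).
Proof.
have := integrable_mul_expR mY intu intv (t := 0); rewrite u0 v0 => /(_ isT).
by congr integrable; apply/funext => w /=; rewrite mul0r expR0 mulr1.
Qed.

Lemma mgf_lt1_near0 : \int[P]_w Y w < 0 -> \forall t \near 0^'+, mgf Y t < 1.
Proof.
move=> EY0; have u0v : u < 0 < v by rewrite u0.
have [mgf_derivable] := is_derive_mgf mY intu intv u0v.
rewrite (@eq_Rintegral _ _ _ _ _ Y) => [mgf_deriv|w _]; last by rewrite mul0r expR0 mulr1.
have mgf_cvg : h^-1 *: (mgf Y h - 1) @[h --> 0^'+] --> \int[P]_w Y w.
  rewrite -mgf_deriv; apply: cvg_dnbhs_at_right.
  rewrite (_ : (fun h => _) = fun h => h^-1 *: ((mgf Y \o shift 0) (h *: 1) - mgf Y 0)).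
    exact: mgf_derivable.
  by apply/funext => h /=; rewrite addr0 [h *: 1]mulr1 mgf0.
near=> t.
have t0 : 0 < t by near: t; exact: nbhs_right_gt.
rewrite -subr_lt0 -(pmulr_rlt0 _ (_ : 0 < t^-1)) ?invr_gt0//.
near: t; exact: cvgr_lt mgf_cvg _ EY0.
Unshelve. all: by end_near. Qed.

Lemma mgf_lt1_exists e : \int[P]_w Y w < 0 -> 0 < e -> exists2 t, 0 < t < e & mgf Y t < 1.
Proof.
move=> EY0 e0; near (0 : R)^'+ => t; exists t.
  by apply/andP; split; near: t; [exact: nbhs_right_gt|exact: nbhs_right_lt].
by near: t; exact: mgf_lt1_near0.
Unshelve. all: by end_near. Qed.

End around0.

Lemma continuous_mgf Y u v t : measurable_fun setT Y ->
  exp_integrable Y u -> exp_integrable Y v -> u < t < v -> {for t, continuous (mgf Y)}.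
Proof.
move=> mY intu intv utv; have [mgf_derivable _] := is_derive_mgf mY intu intv utv.
exact/differentiable_continuous/derivable1_diffP.
Qed.

Lemma mgf_convex Y l s t : 0 <= l -> l <= 1 -> exp_integrable Y s -> exp_integrable Y t ->
  exp_integrable Y (l * s + (1 - l) * t) ->
  mgf Y (l * s + (1 - l) * t) <= l * mgf Y s + (1 - l) * mgf Y t.
Proof.
move=> l0 l1 ints intt intst; rewrite -!RintegralZl// -RintegralD//; try exact: integrable_EFinZl.
apply: le_Rintegral => // [|w _].
  by apply: integrable_EFinD; exact: integrable_EFinZl.
have := convex_expR (Itv01 l0 l1) (s * Y w) (t * Y w).
by rewrite !convRE /unstable.onem/= !mulrA -mulrDl.
Qed.

Lemma mgf_lt1_between Y s p t : measurable_fun setT Y ->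
  exp_integrable Y s -> exp_integrable Y t -> s < p < t -> mgf Y s < 1 -> mgf Y t <= 1 ->
  mgf Y p < 1.
Proof.
move=> mY ints intt /andP[sp pt] mgfs mgft.
have intp : exp_integrable Y p by apply: (exp_integrable_between mY ints intt); rewrite !ltW.
have [l [l0 l1 pE]] : exists l, [/\ 0 < l, l <= 1 & p = l * s + (1 - l) * t].
  have st : 0 < t - s by lra.
  exists ((t - p) / (t - s)); split; last by field; rewrite gt_eqF.
  - by rewrite divr_gt0// subr_gt0.
  - by rewrite ler_pdivrMr// mul1r; lra.
rewrite pE in intp *; apply: le_lt_trans (mgf_convex (ltW l0) l1 ints intt intp) _.
by nra.
Qed.

Lemma mgf_gt1Dx Y s : P.-integrable setT (EFin \o Y) -> exp_integrable Y s -> s != 0 ->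
  (0 < P [set w | Y w != 0%R])%E -> 1 + s * \int[P]_w Y w < mgf Y s.
Proof.
move=> intY ints s0 PY.
have intsY := integrable_EFinZl s intY; have int1 := integrable_probability_cst 1.
have -> : 1 + s * \int[P]_w Y w = \int[P]_w (1 + s * Y w).
  by rewrite RintegralD// Rintegral_probability_cst RintegralZl.
apply: lt_Rintegral => // [|w|]; first exact: integrable_EFinD.
  exact: expR_ge1Dx.
have mY : measurable_fun setT Y by apply/measurable_EFinP; exact: measurable_int intY.
apply: lt_le_trans PY _; apply: le_measure; rewrite ?inE.
- exact: measurable_neq0.
- apply: measurable_lt_fun; last exact: measurable_expRM.
  by apply: measurable_funD => //; exact: measurable_funM.
by move=> w /= Yw; apply: expR_gt1Dx; rewrite mulf_neq0.
Qed.

Lemma mgf_ge1_exists Y t : measurable_fun setT Y -> (forall u, 0 <= u -> exp_integrable Y u) ->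
  (0 < P [set w | (0 < Y w)%R])%E -> exists2 v, t < v & 1 <= mgf Y v.
Proof.
move=> mY intY PY; pose Ypos w := Num.max 0 (Y w).
have mYpos : measurable_fun setT Ypos by exact: measurable_maxr.
have intYpos : P.-integrable setT (EFin \o Ypos).
  apply: (dominated_integrable mYpos _ (intY 1 ler01)) => w.
  by rewrite ger0_norm ?le_max ?lexx// -[leLHS]mul1r mul_max0_le_expR.
have EYpos : 0 < \int[P]_w Ypos w.
  apply: Rintegral_gt0 => // [w|]; first by rewrite le_max lexx.
  by rewrite (_ : [set w | _] = [set w | 0 < Y w])//; apply/seteqP; split => w /=;
    rewrite lt_max ltxx.
pose v := Num.max (t + 1) (\int[P]_w Ypos w)^-1.
have v0 : 0 <= v by rewrite le_max invr_ge0 (ltW EYpos) orbT.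
exists v; first by rewrite lt_max ltrDl ltr01.
apply: (@le_trans _ _ (v * \int[P]_w Ypos w)).
  by rewrite -ler_pdivrMr// div1r le_max lexx orbT.
rewrite -RintegralZl//; apply: le_Rintegral => // [||w _]; first exact: integrable_EFinZl.
  exact: intY.
exact: mul_max0_le_expR.
Qed.

Lemma mgf_eq1_exists Y u : u < 0 -> measurable_fun setT Y ->
  (forall t, u <= t -> exp_integrable Y t) -> (0 < P [set w | (0 < Y w)%R])%E ->
  \int[P]_w Y w < 0 -> exists2 s, 0 < s & mgf Y s = 1.
Proof.
move=> u0 mY intY PY EY.
have intY0 t : 0 <= t -> exp_integrable Y t by move=> t0; apply: intY; lra.
have [t /andP[t0 _] mgft] :=
  mgf_lt1_exists u0 ltr01 mY (intY _ (lexx u)) (intY0 _ ler01) EY ltr01.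
have [v tv mgfv] := mgf_ge1_exists t mY intY0 PY.
have [||s] := @IVT R (mgf Y) t v 1 (ltW tv).
- apply: continuous_in_subspaceT => s; rewrite inE/= in_itv/= => /andP[ts sv].
  apply: (continuous_mgf mY (intY0 _ (lexx 0)) (intY0 (v + 1) _)); lra.
- by rewrite ge_min le_max (ltW mgft) mgfv orbT.
by rewrite in_itv/= => /andP[ts _] mgfs; exists s => //; exact: lt_le_trans ts.
Qed.

End mgf.

(** * Moments of the standard normal law *)

Section powR_calculus.
Context {R : realType}.
Local Notation mu := (@lebesgue_measure R).
Implicit Types p q x : R.

Lemma is_derive_powR q x : 0 < x -> is_derive x 1 (@powR R ^~ q) (q * x `^ (q - 1)).
Proof.
move=> x0; have x_pos : x \in `]0, +oo[ by rewrite in_itv/= x0.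
by split; [exact: derivable_powR|rewrite -derive1E powR_derive1].
Qed.

Lemma continuous_powR q x : 0 < x -> {for x, continuous (@powR R ^~ q)}.
Proof.
move=> x0; have [d_powR _] := is_derive_powR q x0.
exact/differentiable_continuous/derivable1_diffP.
Qed.

Lemma integral_powR_itv q x : -1 < q -> 0 < x < 1 ->
  (\int[mu]_(y in `[x, 1%R]) (y `^ q)%:E <= (q + 1)^-1%:E)%E.
Proof.
move=> q1 /andP[x0 x1]; have q1_gt0 : 0 < q + 1 by lra.
pose F (y : R) : R := (q + 1)^-1 * y `^ (q + 1).
have dF (y : R) : 0 < y -> is_derive y 1 F (y `^ q).
  move=> y0; have := is_deriveZ (q + 1)^-1 (is_derive_powR (q + 1) y0).
  by rewrite addrK [_ *: _]mulrA mulVf ?gt_eqF// mul1r.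
have cF (y : R) : 0 < y -> {for y, continuous F}.
  by move=> y0; have [dFy _] := dF y y0; exact/differentiable_continuous/derivable1_diffP.
rewrite (@continuous_FTC2 _ _ F)//.
- rewrite -EFinB lee_fin /F powR1 mulr1 lerBlDr lerDl.
  by rewrite mulr_ge0 ?powR_ge0// invr_ge0 ltW.
- apply: continuous_in_subspaceT => y; rewrite inE/= in_itv/= => /andP[xy _].
  by apply: continuous_powR; exact: lt_le_trans xy.
- split => [y||].
  + by rewrite in_itv/= => /andP[xy _]; have [] := dF y (lt_trans x0 xy).
  + exact/cvg_at_right_filter/cF.
  + exact/cvg_at_left_filter/cF.
- move=> y; rewrite in_itv/= => /andP[xy _].
  by rewrite derive1E; have [_ ->] := dF y (lt_trans x0 xy).
Qed.

Lemma integral_powR_itv01 q : -1 < q ->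
  (\int[mu]_(y in `]0%R, 1%R]) (y `^ q)%:E <= (q + 1)^-1%:E)%E.
Proof.
move=> q1; pose F n : set R := `[n.+2%:R^-1, 1%R]%classic.
have FE : \bigcup_n F n = `]0%R, 1%R]%classic.
  apply/seteqP; split => [y [n _]|y]/=; rewrite /F/= !in_itv/= => /andP[y0 y1]; rewrite ?y1 ?andbT.
    by apply: lt_le_trans y0; rewrite invr_gt0.
  exists (Num.trunc y^-1) => //=; rewrite in_itv/= y1 andbT.
  rewrite -[leRHS]invrK lef_pV2 ?posrE ?invr_gt0//.
  by rewrite (le_trans (ltW (truncnS_gt _)))// ler_nat.
have F_integral : (\int[mu]_(y in F n) (y `^ q)%:E)%E @[n --> \oo] -->
    (\int[mu]_(y in `]0%R, 1%R]) (y `^ q)%:E)%E.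
  rewrite -FE; apply: ge0_nondecreasing_set_cvg_integral => //.
  - move=> m n mn; apply/subsetPset => y; rewrite /F/= !in_itv/= => /andP[my ->].
    by rewrite andbT (le_trans _ my)// lef_pV2 ?posrE// ler_nat.
  - by move=> n; exact: measurable_itv.
  - by move=> n; apply/measurable_funTS/measurable_EFinP; exact: measurable_powR.
  - by move=> n y _; rewrite lee_fin powR_ge0.
rewrite -(cvg_lim _ F_integral)//; apply: lime_le; first exact: cvgP F_integral.
apply: nearW => n; apply: integral_powR_itv => //.
by rewrite invr_gt0 ltr0n invf_lt1 ?ltr1n.
Qed.

End powR_calculus.

Section normal_moments.
Context {R : realType}.
Local Notation mu := (@lebesgue_measure R).
Local Notation std := (normal_prob (0 : R) 1).

Lemma normal_prob_set1 (m s x : R) : normal_prob m s [set x] = 0%E.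
Proof. exact: integral_set1. Qed.

Lemma normal_prob_itv_gt0 (c : R) : (0 < std `[c, (c + 1)%R])%E.
Proof.
pose lower := normal_peak 1 * expR (- (`|c| + 1) ^+ 2 / (1 ^+ 2 *+ 2)) : R.
have lower_gt0 : 0 < lower by rewrite mulr_gt0 ?expR_gt0// normal_peak_gt0// oner_neq0.
apply: (@lt_le_trans _ _ lower%:E); first by rewrite lte_fin.
have -> : lower%:E = (\int[mu]_(x in `[c, (c + 1)%R]) lower%:E)%E.
  rewrite integral_cst//= lebesgue_measure_itv/= lte_fin ltrDl ltr01.
  by rewrite -EFinB addrAC subrr add0r mule1.
apply: ge0_le_integral => //=.
- by move=> x _; rewrite lee_fin ltW.
- by apply/measurable_funTS/measurable_EFinP; exact: measurable_normal_pdf.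
- move=> x; rewrite in_itv/= => /andP[cx xc]; rewrite lee_fin.
  rewrite normal_pdfE ?oner_neq0// /lower ler_wpM2l ?normal_peak_ge0//.
  rewrite /normal_fun ler_expR subr0 !mulNr lerN2 ler_wpM2r//.
  rewrite -[x ^+ 2]real_normK ?num_real// ler_sqr ?nnegrE//.
  by rewrite -[x](subrKC c) (le_trans (ler_normD _ _))// lerD2l ger0_norm; lra.
Qed.

Lemma integral_normal_expRM (c : R) :
  (\int[std]_z (expR (c * z))%:E = (expR (c ^+ 2 / 2))%:E)%E.
Proof.
have mexp : measurable_fun setT (fun z : R => (expR (c * z))%:E).
  by apply/measurable_EFinP; apply: measurableT_comp => //; exact: measurable_funM.
rewrite (ge0_integral_normal_prob 0 1 mexp) => [|z]; last by rewrite lee_fin expR_ge0.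
transitivity (\int[mu]_z ((expR (c ^+ 2 / 2))%:E * (normal_pdf c 1 z)%:E))%E.
  apply: eq_integral => z _; rewrite -!EFinM; congr _%:E.
  rewrite !normal_pdfE ?oner_neq0// mulrCA [RHS]mulrCA; congr (_ * _).
  by rewrite /normal_fun -!expRD; congr expR; field.
rewrite ge0_integralZl ?integral_normal_pdf ?mule1//.
- exact: measurable_normal_pdfE.
- by move=> z _; rewrite lee_fin normal_pdf_ge0.
Qed.

Lemma ge0_integral_normal_prob_le (m s : R) (f : R -> \bar R) : s != 0 ->
  measurable_fun setT f -> (forall z, 0 <= f z)%E ->
  (\int[normal_prob m s]_z f z <= (normal_peak s)%:E * \int[mu]_z f z)%E.
Proof.
move=> s0 mf f0; rewrite (ge0_integral_normal_prob m s mf f0).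
rewrite -ge0_integralZl// ?lee_fin ?normal_peak_ge0//.
apply: ge0_le_integral => //.
- by move=> z _; rewrite mule_ge0// lee_fin normal_pdf_ge0.
- by apply: emeasurable_funM => //; exact: measurable_normal_pdfE.
- exact: emeasurable_funM.
- by move=> z _; rewrite muleC lee_wpmul2r// lee_fin normal_pdf_ub.
Qed.

Lemma powR_majorant (q : R) : -1 < q < 0 -> exists h : R -> \bar R,
  [/\ measurable_fun setT h, forall z, (0 <= h z)%E, (\int[std]_z h z < +oo)%E &
      forall z, ((`|z| `^ q)%:E <= 1 + (h z + h (-1 * z)%R))%E].
Proof.
move=> /andP[q1 q0]; pose D : set R := `]0%R, 1%R]%classic.
pose h : R -> \bar R := (fun z => (z `^ q)%:E) \_ D.
have h0 z : (0 <= h z)%E by apply: erestrict_ge0 => {}z _; rewrite lee_fin powR_ge0.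
have hE z : D z -> h z = (z `^ q)%:E by move=> Dz; rewrite /h patchE mem_set.
have mh : measurable_fun setT h.
  apply/(measurable_restrictT _ (measurable_itv _))/measurable_funTS/measurable_EFinP.
  exact: measurable_powR.
exists h; split=> // [|z].
  apply: le_lt_trans (ge0_integral_normal_prob_le 0 (oner_neq0 R) mh h0) _.
  apply: lte_mul_pinfty => //; first by rewrite lee_fin normal_peak_ge0.
  by rewrite -integral_mkcond (le_lt_trans (integral_powR_itv01 q1))// ltry.
have [z1|z1] := ltP 1 `|z|.
  apply: (@le_trans _ _ 1%E); last by rewrite leeDl// adde_ge0.
  by rewrite lee_fin -(powRr0 `|z|); apply: ler_powR; exact: ltW.
have [->|z0] := eqVneq z 0.
  by rewrite normr0 powR0 ?lt_eqF// !adde_ge0.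
apply: (@le_trans _ _ (h z + h (-1 * z)%R)%E); last by rewrite leeDr.
move: z1; rewrite mulN1r; case: (ltrgt0P z) z0 => // z0 _ z1.
- by rewrite (hE z) ?leeDl// /D/= in_itv/= z0.
- by rewrite (hE (- z)) ?leeDr// /D/= in_itv/= oppr_gt0 z0.
Qed.

Lemma integral_normal_powR_lty (q : R) : -1 < q < 0 ->
  (\int[std]_z (`|z| `^ q)%:E < +oo)%E.
Proof.
move=> /powR_majorant[h [mh h0 int_h le_h]].
have mhN : measurable_fun setT (fun z : R => h (-1 * z)).
  by apply: (measurableT_comp mh); exact: measurable_funM.
have int_hN : (\int[std]_z h (-1 * z)%R = \int[std]_z h z)%E.
  rewrite (ge0_integral_normal_prob_norm (-1) mh h0).
  by apply: eq_integral => z _; rewrite normrN1 mul1r.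
apply: (@le_lt_trans _ _ (\int[std]_z (1 + (h z + h (-1 * z)%R)))%E).
  apply: ge0_le_integral => //.
  - by apply/measurable_EFinP; exact: measurableT_comp (measurable_powR q) _.
  - by apply: emeasurable_funD => //; exact: emeasurable_funD.
rewrite ge0_integralD//; [|by move=> z _; rewrite adde_ge0|exact: emeasurable_funD].
rewrite integral_probability_cst ge0_integralD// int_hN.
by apply: lte_add_pinfty; [exact: ltry|exact: lte_add_pinfty].
Qed.

End normal_moments.

(** * Moments of the gain of a layer *)

Lemma expR_sum_normr_le {R : realType} (n : nat) (c : R) (z : 'I_n -> R) :
  (0 < n)%N -> 0 <= c ->
  expR (c * \sum_i `|z i|) <=
  \sum_i (expR (c * n%:R * z i) + expR (- (c * n%:R) * z i)).
Proof.
move=> n0 c0; pose i0 := Ordinal n0.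
have [i _ z_max] := @arg_maxP _ _ _ i0 xpredT (fun i => `|z i|) isT.
have sum_le : \sum_j `|z j| <= n%:R * `|z i|.
  apply: le_trans (ler_sum _ (fun j _ => z_max j isT)) _.
  by rewrite sumr_const card_ord mulr_natl.
have summand_ge0 j : 0 <= expR (c * n%:R * z j) + expR (- (c * n%:R) * z j).
  by rewrite addr_ge0 ?expR_ge0.
rewrite [leRHS](bigD1 i)//=; apply: ler_wpDr; first exact: sumr_ge0.
apply: (@le_trans _ _ (expR (c * n%:R * `|z i|))).
  by rewrite ler_expR -mulrA ler_wpM2l.
case: (ger0P (z i)) => _; first by rewrite lerDl expR_ge0.
by rewrite mulrN mulNr lerDr expR_ge0.
Qed.

Lemma exp_integrable_gaussian {R : realType} {d : measure_display} {T : measurableType d}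
    (P : probability T R) (X : T -> R) (s c : R) :
  measurable_fun setT X -> gaussian P s X -> exp_integrable P X c.
Proof.
move=> mX gX; have mexp : measurable_fun setT (fun x : R => (expR (c * x))%:E).
  by apply/measurable_EFinP; exact: measurable_expRM.
apply/integrableP; split; first exact: measurableT_comp mexp mX.
under eq_integral do rewrite /= ger0_norm ?expR_ge0//.
rewrite (gX _ mexp) => [|x]; last by rewrite lee_fin expR_ge0.
under eq_integral do rewrite mulrA.
by rewrite integral_normal_expRM ltry.
Qed.

Section gain.
Context {R : realType} {dT : measure_display} {T : measurableType dT}.
Variables (P : probability T R) (d : nat) (a : R) (Z : 'I_d -> T -> R).
Hypotheses (d0 : (0 < d)%N) (iidZ : iid_gaussian P Z 1).

Let i0 : 'I_d := Ordinal d0.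
Let mZ : forall i, measurable_fun setT (Z i). Proof. by have [] := iidZ. Qed.
Let lawZ i (B : set R) : measurable B -> P (Z i @^-1` B) = normal_prob 0 1 B.
Proof. by have [_ h _] := iidZ; exact: h. Qed.
Let mgain : measurable_fun setT (gain a Z). Proof. exact: measurable_gain. Qed.
Let mpreimageZ i (B : set R) : measurable B -> measurable (Z i @^-1` B).
Proof. by move=> mB; rewrite -[X in measurable X]setTI; exact: mZ. Qed.

Lemma normr_prelu_le_gain i w : `|prelu a (Z i w)| <= gain a Z w.
Proof.
by have := normr_le_enorm (prelu_vec a (\col_i Z i w)) i; rewrite !mxE.
Qed.

(* For [a = 0] the gain vanishes when no [Z i] is positive. *)
Lemma probability_gain_neq0_lt1 : a = 0 -> (P [set w | gain a Z w != 0%R] < 1)%E.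
Proof.
move=> a0; have [_ _ indepZ] := iidZ.
pose neg : set R := `]-oo, 0%R]%classic.
have mneg : measurable neg by exact: measurable_itv.
pose A := \bigcap_(i in [set` index_enum 'I_d]) Z i @^-1` neg.
have mA : measurable A.
  by rewrite /A bigcap_seq; apply: bigsetI_measurable => i _; exact: mpreimageZ.
have PA : (0 < P A)%E.
  rewrite /A bigcap_seq (indepZ _ (fun=> neg)) ?index_enum_uniq//.
  apply: (@big_ind _ (fun x => 0 < x)%E) => //; first exact: mule_gt0.
  move=> i _; rewrite lawZ//; apply: lt_le_trans (normal_prob_itv_gt0 (-1)) _.
  by apply: le_measure; rewrite ?inE// => x; rewrite /neg/= !in_itv/= addNr => /andP[].
apply: (@le_lt_trans _ _ (P (~` A))).
  apply: le_measure; rewrite ?inE; [exact: measurable_neq0|exact: measurableC|].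
  move=> w /= gain_neq0 Aw; move/eqP: gain_neq0; apply; apply/eqP.
  rewrite -sqrf_eq0 sqr_enorm; apply/eqP/big1 => i _; rewrite !mxE.
  have := Aw i (mem_index_enum i); rewrite /neg/= in_itv/= => Zi.
  by rewrite /prelu ltNge Zi/= a0 mul0r expr0n.
by rewrite probability_setC// lteBlDr ?fin_num_measure// lteDl ?fin_num_measure.
Qed.

Hypothesis a01 : 0 < a <= 1.

Let a0 : 0 < a. Proof. by have /andP[] := a01. Qed.
Let a_in01 : 0 <= a <= 1. Proof. by have /andP[/ltW -> ->] := a01. Qed.

Lemma mul_normr_le_gain i w : a * `|Z i w| <= gain a Z w.
Proof. exact: le_trans (normr_prelu_ge _ a_in01) (normr_prelu_le_gain i w). Qed.

Lemma gain_le_sum w : gain a Z w <= \sum_i `|Z i w|.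
Proof.
apply: le_trans (enorm_le_sum _) _; apply: ler_sum => i _.
by rewrite !mxE normr_prelu_le.
Qed.

Lemma ae_iid_gaussian_neq0 i : {ae P, forall w, Z i w != 0}.
Proof.
exists (Z i @^-1` [set 0]); split; first exact: mpreimageZ.
- by rewrite lawZ//; exact: normal_prob_set1.
- by move=> w /= /negP; rewrite negbK => /eqP.
Qed.

Lemma ae_gain_gt0 : {ae P, forall w, 0 < gain a Z w}.
Proof.
apply: filterS (ae_iid_gaussian_neq0 i0) => w Z0.
by apply: lt_le_trans (mul_normr_le_gain i0 w); rewrite mulr_gt0 ?normr_gt0.
Qed.

Lemma probability_gain_neq0 : P [set w | gain a Z w != 0%R] = 1%E.
Proof.
rewrite -integral_nonzero// -[RHS](integral_probability_cst P).
apply: ae_eq_integral => //.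
  by apply/measurable_EFinP; exact: measurableT_comp measurable_nonzero mgain.
by apply: filterS ae_gain_gt0 => w gain0 _; rewrite /nonzero gt_eqF.
Qed.

Variable sigma : R.
Hypothesis sigma0 : 0 < sigma.

Definition log_gain (w : T) : R := ln (sigma * gain a Z w).

Lemma measurable_log_gain : measurable_fun setT log_gain.
Proof. by apply: measurableT_comp => //; exact: measurable_funM. Qed.

Lemma exp_integrable_log_gain_ge0 t : 0 <= t -> exp_integrable P log_gain t.
Proof.
move=> t0; pose c := t * sigma.
have c0 : 0 <= c by rewrite mulr_ge0// ltW.
have mexp := measurable_expRM t measurable_log_gain.
apply: (dominated_integrable (g := fun w =>
  \sum_i (expR (c * d%:R * Z i w) + expR (- (c * d%:R) * Z i w))) mexp) => [w|].
  rewrite ger0_norm ?expR_ge0//; apply: le_trans (expR_sum_normr_le (Z ^~ w) d0 c0).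
  rewrite ler_expR -mulrA ler_wpM2l//; apply: (@le_trans _ _ (sigma * gain a Z w)).
    have := gain_ge0 a Z w; rewrite /log_gain le_eqVlt => /predU1P[<-|gain0].
      by rewrite mulr0 ln0.
    by rewrite ltW// ln_sublinear// mulr_gt0.
  by rewrite ler_wpM2l ?gain_le_sum// ltW.
rewrite (_ : _ \o _ = fun w =>
  \sum_i (expR (c * d%:R * Z i w) + expR (- (c * d%:R) * Z i w))%:E)%E; last first.
  by apply/funext => w /=; rewrite sumEFin.
apply: integrable_sum => // i _; have gZ := iid_gaussian_gaussian i ltr01 iidZ.
have expZ k : exp_integrable P (Z i) k by exact: exp_integrable_gaussian gZ.
exact: integrable_EFinD (expZ _) (expZ _).
Qed.

Lemma exp_integrable_log_gainN : exp_integrable P log_gain (- 2^-1).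
Proof.
have mexp := measurable_expRM (- 2^-1) measurable_log_gain.
have mpowR c : measurable_fun setT (fun x : R => ((c * `|x|) `^ (- 2^-1))%:E).
  apply/measurable_EFinP; apply: (measurableT_comp (measurable_powR _)).
  exact: measurable_funM.
have sa0 : 0 < sigma * a by rewrite mulr_gt0.
apply/integrableP; split; first exact/measurable_EFinP.
under eq_integral do rewrite /= ger0_norm ?expR_ge0//.
apply: (@le_lt_trans _ _ (\int[P]_w ((sigma * a * `|Z i0 w|) `^ (- 2^-1))%:E)%E).
  apply: ae_ge0_le_integral => //.
  - exact/measurable_EFinP.
  - by move=> w _; rewrite lee_fin powR_ge0.
  - exact: measurableT_comp (mpowR _) (mZ i0).
  apply: filterS (ae_iid_gaussian_neq0 i0) => w Z0 _.
  have saZ : 0 < sigma * a * `|Z i0 w| by rewrite mulr_gt0 ?normr_gt0.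
  rewrite lee_fin /powR gt_eqF// ler_expR !mulNr lerN2 ler_wpM2l// ler_ln ?posrE//.
    by rewrite -mulrA ler_wpM2l ?(ltW sigma0)// mul_normr_le_gain.
  by rewrite mulr_gt0// (lt_le_trans _ (mul_normr_le_gain i0 w))// mulr_gt0 ?normr_gt0.
rewrite (iid_gaussian_gaussian i0 ltr01 iidZ (mpowR _)) => [|x]; last by rewrite lee_fin powR_ge0.
under eq_integral do rewrite mul1r powRM ?(ltW sa0)// EFinM.
rewrite ge0_integralZl ?lee_fin ?powR_ge0//.
- apply: lte_mul_pinfty; rewrite ?lee_fin ?powR_ge0//.
  by apply: integral_normal_powR_lty; lra.
- by apply/measurable_EFinP; exact: measurableT_comp (measurable_powR _) _.
Qed.

Lemma exp_integrable_log_gain t : - 2^-1 <= t -> exp_integrable P log_gain t.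
Proof.
move=> t2; have [|t0] := leP 0 t; first exact: exp_integrable_log_gain_ge0.
apply: (exp_integrable_between measurable_log_gain exp_integrable_log_gainN
  (exp_integrable_log_gain_ge0 (lexx 0))).
by rewrite t2 ltW.
Qed.

Lemma integrable_log_gain : P.-integrable setT (EFin \o log_gain).
Proof.
have half0 : - 2^-1 < 0 :> R by lra.
exact: (integrable_of_exp_integrable half0 ltr01 measurable_log_gain
  exp_integrable_log_gainN (exp_integrable_log_gain_ge0 ler01)).
Qed.

Lemma probability_log_gain_gt0 : (0 < P [set w | (0 < log_gain w)%R])%E.
Proof.
pose c := sigma^-1 + 1; have c0 : 0 < c by rewrite addr_gt0 ?invr_gt0.
apply: (@lt_le_trans _ _ (P (Z i0 @^-1` `[c, (c + 1)%R]%classic))).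
  by rewrite lawZ//; exact: normal_prob_itv_gt0.
apply: le_measure; rewrite ?inE; first exact: mpreimageZ.
  exact: measurable_lt_fun (measurable_cst _) measurable_log_gain.
move=> w /=; rewrite in_itv/= => /andP[cZ _]; apply: ln_gt0.
have cgain : c <= gain a Z w.
  apply: le_trans (normr_prelu_le_gain i0 w); have Z0 := lt_le_trans c0 cZ.
  by rewrite /prelu Z0 gtr0_norm.
apply: (@lt_le_trans _ _ (sigma * c)); last by rewrite ler_wpM2l// ltW.
by rewrite mulrDr mulr1 divff ?gt_eqF// ltrDl.
Qed.

Lemma probability_log_gain_neq0 : (0 < P [set w | (log_gain w != 0)%R])%E.
Proof.
apply: lt_le_trans probability_log_gain_gt0 _; apply: le_measure; rewrite ?inE.
- exact: measurable_lt_fun (measurable_cst _) measurable_log_gain.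
- exact: measurable_neq0 measurable_log_gain.
- by move=> w /= /lt0r_neq0.
Qed.

Lemma integral_powR_gain t : - 2^-1 <= t ->
  (\int[P]_w ((sigma * gain a Z w) `^ t)%:E = (mgf P log_gain t)%:E)%E.
Proof.
move=> t2; rewrite fineK; last exact: integrable_fin_num (exp_integrable_log_gain t2).
apply: ae_eq_integral => //.
- apply/measurable_EFinP; apply: (measurableT_comp (measurable_powR t)).
  exact: measurable_funM.
- by apply/measurable_EFinP; exact: measurable_expRM measurable_log_gain.
- apply: filterS ae_gain_gt0 => w gain0 _.
  by rewrite /powR mulf_eq0 (gt_eqF sigma0) (gt_eqF gain0).
Qed.

Lemma mu_aE : mu_a P Z a sigma = (\int[P]_w log_gain w)%:E.
Proof.
have intY := integrable_log_gain.
have mln : measurable_fun setT (fun w => (ln (gain a Z w ^+ 2))%:E).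
  apply/measurable_EFinP; apply: measurableT_comp => //; exact: measurable_funX.
have ln_sqr : (\int[P]_w (ln (gain a Z w ^+ 2))%:E =
    (2 * (\int[P]_w log_gain w - ln sigma))%:E)%E.
  have intYsigma : P.-integrable setT (EFin \o (fun w => log_gain w - ln sigma)).
    exact: integrable_EFinD intY (integrable_probability_cst _ _).
  rewrite -[X in _ - X](Rintegral_probability_cst P) -RintegralB//; last first.
    exact: integrable_probability_cst.
  rewrite -RintegralZl// fineK; last exact: integrable_fin_num (integrable_EFinZl 2 intYsigma).
  apply: ae_eq_integral => //; first exact: measurable_int (integrable_EFinZl 2 intYsigma).
  apply: filterS ae_gain_gt0 => w gain0 _ /=; congr _%:E.
  by rewrite /log_gain lnM ?posrE// addrAC subrr add0r lnXn// mulr_natl.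
rewrite /mu_a -[X in (_ + _ * X)%E]/(\int[P]_w (ln (gain a Z w ^+ 2))%:E)%E ln_sqr.
by rewrite -EFinM mulKf// -EFinD addrC subrK.
Qed.

Lemma sigma_barE s : 0 < s ->
  sigma_bar P Z a s = sigma * mgf P log_gain s `^ (- s^-1).
Proof.
move=> s0; have s2 : - 2^-1 <= s by lra.
have s_neq0 : s != 0 by rewrite gt_eqF.
have sigmas : sigma `^ s != 0 by rewrite gt_eqF// powR_gt0.
have gain_moment : (\int[P]_w (gain a Z w `^ s)%:E =
    (sigma `^ (- s) * mgf P log_gain s)%:E)%E.
  rewrite EFinM -integral_powR_gain//.
  under [in RHS]eq_integral do rewrite powRM ?gain_ge0 ?(ltW sigma0)// EFinM.
  rewrite ge0_integralZl// ?lee_fin ?powR_ge0//; last first.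
  - by move=> w _; rewrite lee_fin powR_ge0.
  - by apply/measurable_EFinP; exact: measurableT_comp (measurable_powR s) mgain.
  by rewrite muleA -EFinM powRN mulVf// mul1e.
rewrite -[sigma_bar _ _ _ _]/(fine (\int[P]_w (gain a Z w `^ s)%:E)%E `^ (- s^-1)).
rewrite gain_moment/= powRM ?powR_ge0 ?mgf_ge0// -powRrM mulrNN divff//.
by rewrite powRr1// ltW.
Qed.

Lemma sigma_barP s : 0 < s -> sigma = sigma_bar P Z a s <-> mgf P log_gain s = 1.
Proof.
move=> s0; have s_neq0 : s != 0 by rewrite gt_eqF.
rewrite sigma_barE//; split=> [|->]; last by rewrite powR1 mulr1.
rewrite -[LHS]mulr1 => /(mulfI (lt0r_neq0 sigma0)) mgf_powR.
have := congr1 (@powR R ^~ (- s)) mgf_powR.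
by rewrite powR1 -powRrM mulrNN mulVf// powRr1 ?mgf_ge0.
Qed.

End gain.

(** * Limits of the layers *)

Section powR_limits.
Context {R : realType}.
Implicit Type u : R^nat.

Lemma cvg0_of_powR u (p : R) : 0 < p -> (forall k, 0 <= u k) ->
  u k `^ p @[k --> \oo] --> 0 -> u @ \oo --> 0.
Proof.
move=> p0 u0 /cvgrPdist_lt up; apply/cvgrPdist_lt => e e0.
apply: filterS (up _ (powR_gt0 p e0)) => k.
rewrite !sub0r !normrN !ger0_norm ?powR_ge0//; apply: contraTT; rewrite -!leNgt => eu.
by rewrite ge0_ler_powR ?nnegrE// ltW.
Qed.

Lemma cvgy_of_powRN u (p : R) : 0 < p -> (forall k, 0 < u k) ->
  u k `^ (- p) @[k --> \oo] --> 0 -> u @ \oo --> +oo.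
Proof.
move=> p0 u0 up; apply/gtr0_cvgV0; first exact: nearW.
apply: (cvg0_of_powR p0) => [k|]; first by rewrite invr_ge0 ltW.
by under eq_fun do rewrite /= -powR_inv1 ?ltW// -powRrM mulN1r.
Qed.

Lemma cvgy_geometric (c r : R) : 0 < c -> 1 < r -> geometric c r @ \oo --> +oo.
Proof.
move=> c0 r1; have r0 := lt_trans ltr01 r1.
apply/gtr0_cvgV0; first by apply: nearW => k; rewrite /= mulr_gt0// exprn_gt0.
have inv_cvg0 : geometric c^-1 r^-1 @ \oo --> 0.
  by apply: cvg_geometric; rewrite gtr0_norm ?invr_gt0// invf_lt1.
apply: cvg_trans inv_cvg0; apply: near_eq_cvg; apply: nearW => k.
by rewrite /= invfM exprVn.
Qed.

End powR_limits.

Section layers_limits.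
Context {R : realType} {dT : measure_display} {T : measurableType dT}.
Variables (P : probability T R) (d : nat) (a sigma : R) (x0 : 'cV[R]_d).
Variables (W : nat -> T -> 'M[R]_d) (Z : 'I_d -> T -> R).
Hypotheses (d0 : (0 < d)%N) (a01 : 0 < a <= 1) (sigma0 : 0 < sigma) (x0_neq0 : x0 != 0).
Hypothesis iidW : iid_gaussian P (weight W) sigma.
Hypothesis iidZ : iid_gaussian P Z 1.

Let Y := log_gain a Z sigma.
Let norm_layer k w := enorm (layers a x0 W k w).

Let mY : measurable_fun setT Y. Proof. exact: measurable_log_gain iidZ _. Qed.

Let expY t : - 2^-1 <= t -> exp_integrable P Y t.
Proof. exact: exp_integrable_log_gain. Qed.

Let half0 : - 2^-1 < 0 :> R. Proof. by lra. Qed.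

Let expY_ge0 t : 0 <= t -> exp_integrable P Y t.
Proof. by move=> t0; apply: expY; lra. Qed.

Let mgf_gt1Dx_log_gain s : 0 < s -> 1 + s * \int[P]_w Y w < mgf P Y s.
Proof.
move=> s0; apply: mgf_gt1Dx; [exact: integrable_log_gain|exact/expY_ge0/ltW| |].
- by rewrite gt_eqF.
- exact: probability_log_gain_neq0.
Qed.

Lemma mean_lt0_of_mgf_eq1 s : 0 < s -> mgf P Y s = 1 -> \int[P]_w Y w < 0.
Proof.
move=> s0 mgfs; have := mgf_gt1Dx_log_gain s0.
by rewrite mgfs gtrDl pmulr_rlt0.
Qed.

Lemma mu_a_lt0P : (mu_a P Z a sigma < 0)%E <->
  exists2 s : R, 0 < s & sigma = sigma_bar P Z a s.
Proof.
rewrite (mu_aE d0 iidZ a01 sigma0) lte_fin; split=> [mean_lt0|[s s0 sigmaE]].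
  have [s s0 mgfs] : exists2 s, 0 < s & mgf P Y s = 1.
    apply: mgf_eq1_exists half0 mY expY _ mean_lt0.
    exact: probability_log_gain_gt0.
  by exists s => //; apply/(sigma_barP d0 iidZ a01 sigma0 s0).
by apply: (mean_lt0_of_mgf_eq1 s0); apply/(sigma_barP d0 iidZ a01 sigma0 s0).
Qed.

Lemma mgf_log_gain_lt1 s p : 0 < p < s -> sigma = sigma_bar P Z a s -> mgf P Y p < 1.
Proof.
move=> /andP[p0 ps] sigmaE; have s0 := lt_trans p0 ps.
have mgfs : mgf P Y s = 1 by apply/(sigma_barP d0 iidZ a01 sigma0 s0).
have mean_lt0 := mean_lt0_of_mgf_eq1 s0 mgfs.
have [t /andP[t0 tp] mgft] :=
  mgf_lt1_exists half0 ltr01 mY (expY (lexx _)) (expY_ge0 ler01) mean_lt0 p0.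
apply: (mgf_lt1_between mY (expY_ge0 (ltW t0)) (expY_ge0 (ltW s0))) => //.
- by rewrite tp.
- by rewrite mgfs.
Qed.

Lemma integral_powR_layers p k : - 2^-1 <= p ->
  (\int[P]_w (norm_layer k w `^ p)%:E = (enorm x0 `^ p * mgf P Y p ^+ k)%:E)%E.
Proof.
move=> p2; apply: (integral_multiplicative_layers x0 sigma0 iidW iidZ (g := @powR R ^~ p)).
- exact: measurable_powR.
- by move=> u; exact: powR_ge0.
- by move=> u v; exact: powRM.
- exact: integral_powR_gain.
Qed.

Lemma ae_powR_layers_cvg0 p : - 2^-1 <= p -> mgf P Y p < 1 ->
  {ae P, forall w, norm_layer k w `^ p @[k --> \oo] --> 0}.
Proof.
move=> p2; apply: (ae_multiplicative_layers_cvg0 x0 sigma0 iidW iidZ (g := @powR R ^~ p)).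
- exact: measurable_powR.
- by move=> u; exact: powR_ge0.
- by move=> u v; exact: powRM.
- exact: integral_powR_gain.
Qed.

Lemma ae_layers_cvg0 s : 0 < s -> sigma = sigma_bar P Z a s ->
  {ae P, forall w, norm_layer k w @[k --> \oo] --> 0}.
Proof.
move=> s0 sigmaE; have s20 : 0 < s / 2 by rewrite divr_gt0.
have mgf_lt1 : mgf P Y (s / 2) < 1.
  by apply: mgf_log_gain_lt1 sigmaE; rewrite s20 gtr_pMr// invf_lt1 ?ltr1n.
have s2 : - 2^-1 <= s / 2 by lra.
apply: filterS (ae_powR_layers_cvg0 s2 mgf_lt1) => w.
by apply: cvg0_of_powR s20 _ => k; exact: enorm_ge0.
Qed.

Lemma moment_layers_cvg0 s p : 0 < p < s -> sigma = sigma_bar P Z a s ->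
  (\int[P]_w (norm_layer k w `^ p)%:E)%E @[k --> \oo] --> 0%E.
Proof.
move=> ps sigmaE; have /andP[p0 _] := ps.
have p2 : - 2^-1 <= p by lra.
under eq_fun do rewrite integral_powR_layers//.
apply: cvg_EFin; first exact: nearW.
apply: (@cvg_geometric R (enorm x0 `^ p)).
by rewrite ger0_norm ?mgf_ge0// (mgf_log_gain_lt1 ps).
Qed.

Lemma moment_layers_cvgy p : (0 < mu_a P Z a sigma)%E -> 0 < p ->
  (\int[P]_w (norm_layer k w `^ p)%:E)%E @[k --> \oo] --> +oo%E.
Proof.
rewrite (mu_aE d0 iidZ a01 sigma0) lte_fin => mean_gt0 p0.
have p2 : - 2^-1 <= p by lra.
under eq_fun do rewrite integral_powR_layers//.
apply/cvgeryP; apply: cvgy_geometric; first by rewrite powR_gt0// enorm_gt0.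
by apply: lt_trans (mgf_gt1Dx_log_gain p0); rewrite ltrDl mulr_gt0.
Qed.

Lemma ae_layers_cvgy : (0 < mu_a P Z a sigma)%E ->
  {ae P, forall w, norm_layer k w @[k --> \oo] --> +oo}.
Proof.
rewrite (mu_aE d0 iidZ a01 sigma0) lte_fin => mean_gt0.
have [t /andP[t0 t2]] : exists2 t, 0 < t < 2^-1 & mgf P (\- Y) t < 1.
  apply: (@mgf_lt1_exists _ _ _ _ _ (-1) 2^-1); rewrite ?oppr_lt0 ?invr_gt0//.
  - exact: measurableT_comp.
  - by apply/exp_integrableN; rewrite opprK; exact: expY_ge0.
  - by apply/exp_integrableN; exact: expY.
  - by rewrite RintegralN ?oppr_lt0//; exact: integrable_log_gain.
rewrite mgfN => mgft.
have t2N : - 2^-1 <= - t by rewrite lerN2 ltW.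
apply: filterS2 (ae_powR_layers_cvg0 t2N mgft)
  (ae_layers_gt0 sigma0 iidW iidZ x0_neq0 (probability_gain_neq0 d0 iidZ a01)).
by move=> w xt x_gt0; exact: cvgy_of_powRN xt.
Qed.

End layers_limits.

Theorem mainTheorem9 (R : realType) (dT : measure_display)
  (T : measurableType dT) (P : probability T R) (d : nat)
  (a sigma : R) (x0 : 'cV[R]_d)
  (W : nat -> T -> 'M[R]_d) (Zs : 'I_d -> T -> R) :
  (0 < d)%N -> 0 <= a <= 1 -> 0 < sigma -> x0 != 0 ->
  iid_gaussian P (fun t : nat * 'I_d * 'I_d => fun w => W t.1.1 w t.1.2 t.2) sigma ->
  iid_gaussian P Zs 1 ->
  (* (a) *)
  (a = 0 ->
     {ae P, forall w, (fun k => enorm (layers a x0 W k w)) @ \oo --> 0}) /\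
  (* (b) *)
  (0 < a ->
     ((mu_a P Zs a sigma < 0)%E <-> exists2 s : R, 0 < s & sigma = sigma_bar P Zs a s) /\
     (forall s : R, 0 < s -> sigma = sigma_bar P Zs a s ->
        (1 <= s ->
           {ae P, forall w, (fun k => enorm (layers a x0 W k w)) @ \oo --> 0}) /\
        (s < 1 ->
           (forall p : R, 0 < p < s ->
              (fun k => (\int[P]_w ((enorm (layers a x0 W k w)) `^ p)%:E)%E)
                @ \oo --> 0%E) /\
           (exists nk : nat -> nat, (forall k, (nk k < nk k.+1)%N) /\
              {ae P, forall w,
                 (fun k => enorm (layers a x0 W (nk k) w)) @ \oo --> 0})))) /\
  (* (c) *)
  (0 < a -> (0 < mu_a P Zs a sigma)%E ->
     (forall p : R, 0 < p ->
        (fun k => (\int[P]_w ((enorm (layers a x0 W k w)) `^ p)%:E)%E)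
          @ \oo --> +oo%E) /\
     (exists nk : nat -> nat, (forall k, (nk k < nk k.+1)%N) /\
        {ae P, forall w,
           (fun k => enorm (layers a x0 W (nk k) w)) @ \oo --> +oo})).
Proof.
move=> d0 /andP[a_ge0 a1] sigma0 x0_neq0 iidW iidZ; split; [|split].
- move=> a0; apply: (ae_layers_cvg0_of_gain_eq0 _ sigma0 iidW iidZ).
  exact: (probability_gain_neq0_lt1 iidZ a0).
- move=> a_gt0; have a01 : 0 < a <= 1 by rewrite a_gt0.
  split=> [|s s0 sigmaE]; first exact: (mu_a_lt0P d0 a01 sigma0 iidZ).
  have cvg0 := ae_layers_cvg0 x0 d0 a01 sigma0 iidW iidZ s0 sigmaE.
  split=> // _; split; last by exists id.
  by move=> p ps; exact: (moment_layers_cvg0 x0 d0 a01 sigma0 iidW iidZ ps sigmaE).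
- move=> a_gt0 mu_gt0; have a01 : 0 < a <= 1 by rewrite a_gt0.
  split=> [p p0|]; first exact: (moment_layers_cvgy d0 a01 sigma0 x0_neq0 iidW iidZ).
  by exists id; split=> //; exact: (ae_layers_cvgy d0 a01 sigma0 x0_neq0 iidW iidZ).
Qed.
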